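(* Let $\tau:I\to I$ be a generalized interval exchange map, with associated partition $C=\{a_0,a_1,\ldots,a_n\}$. If the $\tau$-orbits of $a_1,a_2,\ldots,a_{n-1}$ are infinite and disjoint, then $DG(\tau)=C(X,\mathbb Z)$ is isomorphic as an (unordered) $\mathbb Z[t,t^{-1}]$-module to $\mathbb Z[t,t^{-1}]^{n-1}\oplus\mathbb Z$, where the action of $\mathcal L_*$ on the first summand is coordinate-wise multiplication by $t$, and on the second summand is trivial.
   Context: Piecewise monotonic maps. Let $I=[0,1]$. A map $\tau:I\to I$ is piecewise monotonic if there are points $0=a_0<a_1<\dots<a_n=1$ such that $\tau|_{(a_{i-1},a_i)}$ is continuous and strictly monotonic for $1\le i\le n$. $C=\{a_0,\dots,a_n\}$ is the partition associated with $\tau$; it is maximal if the intervals $(a_{i-1},a_i)$ are the largest open intervals on which $\tau$ is continuous and strictly monotonic. $\widehat\tau(x)$ denotes the set of left and right limits of $\tau$ at $x$, $\widehat\tau(A)=\bigcup_{x\in A}\widehat\tau(x)$ and $\widehat\tau^{-1}(A)=\{x\in I\mid \widehat\tau(x)\cap A\ne\emptyset\}$. The generalized orbit $I_1$ of $C$ is the smallest subset of $I$ containing $C$ and closed under $\widehat\tau$ and $\widehat\tau^{-1}$; $I_0=I\setminus I_1$. Generalized interval exchange maps. A piecewise monotonic map $\tau:[0,1)\to[0,1)$ is a generalized interval exchange map if $\tau$ is increasing on each interval of monotonicity, bijective, and right continuous at all points. It is identified with its extension to a map $[0,1]\to[0,1]$ that is left continuous at $1$. The $\tau$-orbit of $x$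 is $\{\tau^kx\mid k\ge0\}$ (using the actual map $\tau$, not the multivalued $\widehat\tau$); the $\tau$-orbits of the points of $B$ are infinite and disjoint if for $b_1,b_2\in B$, $m,n\ge0$, $\tau^mb_1=\tau^nb_2$ implies $b_1=b_2$ and $m=n$. Associated local homeomorphism. The disconnection $X$ of $I$ at points of $I_1$ is the totally ordered set obtained from $I$ by replacing each $x\in I_1\setminus\{0,1\}$ by two points $x^-<x^+$, with the order topology (it is homeomorphic to a compact subset of $\mathbb R$); $\pi:X\to I$ is the collapse map, $\pi(x^\pm)=x$ and $\pi(x)=x$ for $x\in I_0$. With $X_0=\pi^{-1}(I_0)$, the local homeomorphism associated with $\tau$ is the unique continuous map $\sigma:X\to X$ with $\pi\circ\sigma=\tau\circ\pi$ on $X_0$. Dimension module. The transfer map $\mathcal L:C(X,\mathbb Z)\to C(X,\mathbb Z)$ is $(\mathcal Lf)(x)=\sum_{\sigma(y)=x}f(y)$. For $f,g\in C(X,\mathbb Z)$ put $f\sim g$ if $\mathcal L^nf=\mathcal L^ng$ for some $n\ge0$. $DG(\tau)=G_\sigma$ is the group of equivalence classes $[f]$, with $[f]+[g]=[f+g]$; $\mathcal L_*[f]=[\mathcal Lf]$. In the notation $DG(\tau)$ the partition $C$ is taken to be the maximal one. When $\mathcal L_*$ is an automorphism (as here), $DG(\tau)$ is a $\mathbb Z[t,t^{-1}]$-module with $t$ acting as $\mathcal L_*$. The equality $DG(\tau)=C(X,\mathbb Z)$ means that $f\mapsto[f]$ is a bijection from $C(X,\mathbb Z)$ onto $DG(\tau)$.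 *)

(* Defs.v *)
From HB Require Import structures.
From mathcomp Require Import all_boot all_order all_algebra fraction.
From mathcomp Require Import all_classical all_reals all_analysis.

Set Implicit Arguments.
Unset Strict Implicit.
Unset Printing Implicit Defensive.

Import Order.TTheory GRing.Theory Num.Theory numFieldNormedType.Exports.
Import Quotient.Exports.

Local Open Scope classical_set_scope.
Local Open Scope ring_scope.
Local Open Scope quotient_scope.

(* A self-map of I = [0, 1] is given as a function R -> R; only its values on
   [0, 1] are ever used. A partition 0 = a_0 < ... < a_n = 1 is given as a
   function on nat, of which only a 0, ..., a n are used. *)

Section PiecewiseMonotonic.
Context {R : realType}.
Implicit Types (tau : R -> R) (n : nat) (a : nat -> R) (l r x y : R).

Definition cont_strict_mono tau l r :=
  {in `]l, r[, continuous tau} /\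
  ({in `]l, r[ &, {homo tau : x y / x < y}} \/
   {in `]l, r[ &, {homo tau : x y /~ x < y}}).

Definition is_partition n a :=
  [/\ a 0 = 0, a n = 1 & forall i, (i < n)%N -> a i < a i.+1].

Definition piecewise_monotonic tau n a :=
  [/\ tau @` `[0, 1] `<=` `[0, 1],
      is_partition n a &
      forall i, (i < n)%N -> cont_strict_mono tau (a i) (a i.+1)].

Definition maximal_partition tau n a :=
  forall i, (i < n)%N -> forall l r, 0 <= l -> r <= 1 ->
    l <= a i -> a i.+1 <= r -> cont_strict_mono tau l r ->
    l = a i /\ r = a i.+1.

(* The map is bijective on [0, 1[; its value at 1 is the left limit there. *)
Definition interval_exchange tau n a :=
  [/\ piecewise_monotonic tau n a,
      forall i, (i < n)%N -> {in `]a i, a i.+1[ &, {homo tau : x y / x < y}},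
      set_bij `[0, 1[ `[0, 1[ tau,
      forall x, x \in `[0, 1[ -> tau y @[y --> x^'+] --> tau x &
      tau y @[y --> 1^'-] --> tau 1].

Definition infinite_disjoint_orbits tau (B : set R) :=
  forall b1 b2, B b1 -> B b2 -> forall p q : nat,
    iter p tau b1 = iter q tau b2 -> b1 = b2 /\ p = q.

(* One-sided limits are taken inside [0, 1]: no left limit at 0, and no right
   limit at 1. *)
Definition limits tau x : set R :=
  [set y | [/\ 0 < x, x <= 1 & tau z @[z --> x^'-] --> y]] `|`
  [set y | [/\ 0 <= x, x < 1 & tau z @[z --> x^'+] --> y]].

Definition limits_image tau (A : set R) : set R :=
  \bigcup_(x in A) limits tau x.

Definition limits_preimage tau (A : set R) : set R :=
  [set x | x \in `[0, 1] /\ limits tau x `&` A !=set0].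

Definition generalized_orbit tau (C : set R) : set R :=
  smallest [set A | [/\ A `<=` `[0, 1],
                        limits_image tau A `<=` A &
                        limits_preimage tau A `<=` A]] C.

End PiecewiseMonotonic.

(* The disconnection of [0, 1] at the points of D: the pair (x, false) stands
   for x^- if x lies in D \ {0, 1} and for x otherwise, and (x, true), which is
   present only if x lies in D \ {0, 1}, stands for x^+. *)
Section Disconnection.
Context {R : realType}.

Definition in_disconnection (D : set R) (p : R *l bool) : bool :=
  (p.1 \in `[0, 1]) && (p.2 ==> `[< (D `\` [set 0; 1]) p.1 >]).

Record disconnection_of (D : set R) := Disconnection {
  disconnection_val :> R *l bool;
  _ : in_disconnection D disconnection_val }.

HB.instance Definition _ D := [isSub for @disconnection_val D].
HB.instance Definition _ D := [Choice of disconnection_of D by <:].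
HB.instance Definition _ D :=
  [SubChoice_isSubOrder of disconnection_of D by <: with ring_display].

Definition disconnection (D : set R) := order_topology (disconnection_of D).

HB.instance Definition _ D := OrderTopological.on (disconnection D).

Definition collapse (D : set R) (x : disconnection D) : R :=
  (\val (x : disconnection_of D)).1.

End Disconnection.

(* C(X, Z), with pointwise addition *)
Definition cont_int (X : topologicalType) :=
  continuousType X (discrete_topology int).

Section ContInt.
Context {X : topologicalType}.
Local Notation CX := (cont_int X).

HB.instance Definition _ := Choice.on CX.

Definition cont_int_fun (f : CX) : X -> int := f.

Coercion cont_int_fun : cont_int >-> Funclass.

Definition continuous_int (f : X -> int) :=
  continuous (f : X -> discrete_topology int).

Lemma continuous_intP (f : X -> int) :
  continuous_int f <-> forall x, \forall y \near x, f y = f x.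
Proof.
pose g : X -> discrete_topology int := f.
have cvgE x : g @ x --> g x <-> \forall y \near x, f y = f x.
  exact: discrete_cvg.
by split=> cf x; apply/cvgE; exact: cf.
Qed.

Lemma cont_intP (f : CX) : continuous_int f.
Proof. exact: (@cts_fun _ _ f). Qed.

Definition mk_cont_int (f : X -> int) (cf : continuous_int f) : CX :=
  (mkcts cf : continuousType X (discrete_topology int)).

Lemma cont_int_ext (f g : CX) : (forall x, cont_int_fun f x = g x) -> f = g.
Proof. by move=> fg; apply/continuousEP. Qed.

Lemma continuous_int0 : continuous_int (fun=> 0).
Proof. by apply/continuous_intP => x; exact: nearW. Qed.

Lemma continuous_intN (f : CX) : continuous_int (fun x => - cont_int_fun f x).
Proof.
apply/continuous_intP => x.
by have /continuous_intP/(_ x) := @cont_intP f; apply: filterS => y /= ->.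
Qed.

Lemma continuous_intD (f g : CX) :
  continuous_int (fun x => cont_int_fun f x + cont_int_fun g x).
Proof.
apply/continuous_intP => x.
have /continuous_intP/(_ x) := @cont_intP f.
have /continuous_intP/(_ x) := @cont_intP g.
by apply: filterS2 => y /= -> ->.
Qed.

Let zero : CX := mk_cont_int continuous_int0.
Let opp (f : CX) : CX := mk_cont_int (@continuous_intN f).
Let add (f g : CX) : CX := mk_cont_int (@continuous_intD f g).

Let addA : associative add.
Proof. by move=> f g h; apply: cont_int_ext => x; exact: addrA. Qed.
Let addC : commutative add.
Proof. by move=> f g; apply: cont_int_ext => x; exact: addrC. Qed.
Let add0 : left_id zero add.
Proof. by move=> f; apply: cont_int_ext => x; exact: add0r. Qed.
Let addN : left_inverse zero opp add.
Proof. by move=> f; apply: cont_int_ext => x; exact: addNr. Qed.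

HB.instance Definition _ := GRing.isZmodule.Build CX addA addC add0 addN.

End ContInt.

(* Abstract dimension group: V modulo eventual equality under L, together with
   the endomorphism L_* induced by L. *)
Section DimensionGroup.
Context {V : zmodType} (L : {additive V -> V}).

Definition eventually_eq (f g : V) : bool :=
  `[< exists n, iter n L f = iter n L g >].

Let iterD n f g : iter n L (f + g) = iter n L f + iter n L g.
Proof. by elim: n => //= n ->; rewrite raddfD. Qed.
Let iterN n f : iter n L (- f) = - iter n L f.
Proof. by elim: n => //= n ->; rewrite raddfN. Qed.

Let evW f g m n : iter m L f = iter m L g -> iter (n + m) L f = iter (n + m) L g.
Proof. by move=> e; rewrite !(ssrnat.iterD n m) e. Qed.

Lemma eventually_eq_equiv : equiv_class_of eventually_eq.
Proof.
split=> [f|f g|g f h].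
- by apply/asboolP; exists 0%N.
- by apply/asbool_equiv_eq; split=> -[n e]; exists n.
- move=> /asboolP[m e1] /asboolP[n e2]; apply/asboolP; exists (m + n)%N.
  by rewrite [in LHS]addnC (evW n e1) addnC (evW m e2).
Qed.

Canonical eventually_eq_rel := EquivRelPack eventually_eq_equiv.

Definition dimension_group := {eq_quot eventually_eq}.
HB.instance Definition _ := Choice.on dimension_group.
HB.instance Definition _ := EqQuotient.on dimension_group.

Lemma dg_classP f g : \pi_dimension_group f = \pi_dimension_group g <->
  exists n, iter n L f = iter n L g.
Proof. by split=> [/eqmodP/asboolP|e] //; apply/eqmodP/asboolP. Qed.

Let zero : dimension_group := lift_cst dimension_group 0.
Let add := lift_op2 dimension_group +%R.
Let opp := lift_op1 dimension_group -%R.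
Let shift := lift_op1 dimension_group L.

Let pi_add : {morph \pi_dimension_group : f g / f + g >-> add f g}.
Proof.
move=> f g; unlock add.
case: (piP dimension_group f) => f' /dg_classP[m e1].
case: (piP dimension_group g) => g' /dg_classP[n e2].
apply/dg_classP; exists (m + n)%N.
by rewrite !iterD [in X in X + _]addnC [in X in _ = X + _]addnC
  !(evW _ e1) !(evW _ e2).
Qed.
Canonical pi_add_morph := PiMorph2 pi_add.

Let pi_opp : {morph \pi_dimension_group : f / - f >-> opp f}.
Proof.
move=> f; unlock opp; case: (piP dimension_group f) => f' /dg_classP[m e1].
by apply/dg_classP; exists m; rewrite !iterN e1.
Qed.
Canonical pi_opp_morph := PiMorph1 pi_opp.

Let pi_shift : {morph \pi_dimension_group : f / L f >-> shift f}.
Proof.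
move=> f; unlock shift; case: (piP dimension_group f) => f' /dg_classP[m e1].
by apply/dg_classP; exists m; rewrite -!iterSr /= e1.
Qed.

Let addA : associative add.
Proof. by move=> f g h; rewrite -[f]reprK -[g]reprK -[h]reprK !piE addrA. Qed.
Let addC : commutative add.
Proof. by move=> f g; rewrite -[f]reprK -[g]reprK !piE addrC. Qed.
Let add0 : left_id zero add.
Proof. by move=> f; unlock zero; rewrite -[f]reprK !piE add0r. Qed.
Let addN : left_inverse zero opp add.
Proof. by move=> f; unlock zero; rewrite -[f]reprK !piE addNr. Qed.

HB.instance Definition _ :=
  GRing.isZmodule.Build dimension_group addA addC add0 addN.

Definition dg_class (f : V) : dimension_group := \pi f.

Lemma dg_classD : {morph dg_class : f g / f + g}.
Proof. by move=> f g; rewrite /dg_class pi_add. Qed.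

Definition dg_shift (u : dimension_group) : dimension_group := shift u.

Lemma dg_shift_class f : dg_shift (dg_class f) = dg_class (L f).
Proof. by rewrite /dg_class pi_shift. Qed.

Let dg_shift_zmod : zmod_morphism dg_shift.
Proof.
move=> u v; rewrite -[u]reprK -[v]reprK.
have -> : \pi_dimension_group (repr u) - \pi_dimension_group (repr v) =
    dg_class (repr u - repr v) by rewrite /dg_class pi_add pi_opp.
by rewrite !dg_shift_class raddfB /dg_class pi_add pi_opp.
Qed.

HB.instance Definition _ :=
  GRing.isZmodMorphism.Build dimension_group dimension_group dg_shift
    dg_shift_zmod.

End DimensionGroup.

(* The local homeomorphism, transfer map and dimension group attached to tau
   and its associated partition C. *)
Section DG.
Context {R : realType} (tau : R -> R) (C : set R).

Definition disc_space := disconnection (generalized_orbit tau C).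

HB.instance Definition _ := OrderTopological.on disc_space.

Definition is_associated_map (sigma : disc_space -> disc_space) :=
  continuous sigma /\
  forall x, ~ generalized_orbit tau C (collapse x) ->
    collapse (sigma x) = tau (collapse x).

(* The unique map satisfying is_associated_map; the identity is a junk value,
   for the case where there is no such map. *)
Definition associated_map : disc_space -> disc_space :=
  xget (id : disc_space -> disc_space) [set sigma | is_associated_map sigma].

Definition is_transfer (L : {additive cont_int disc_space -> cont_int disc_space}) :=
  forall (f : cont_int disc_space) (x : disc_space),
    L f x = \sum_(y \in [set y | associated_map y = x]) f y.

(* The formula in is_transfer determines an additive endomorphism of C(X, Z) as
   soon as the right-hand sides are finite sums depending continuously on x;
   the null morphism is a junk value, for when this fails. *)
Definition transfer : {additive cont_int disc_space -> cont_int disc_space} :=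
  if pselect (exists L, is_transfer L) is left exL then sval (cid exL)
  else \0.

Definition DG := dimension_group transfer.

HB.instance Definition _ := GRing.Zmodule.on DG.

Definition DG_class : cont_int disc_space -> DG := @dg_class _ transfer.

Definition DG_shift : {additive DG -> DG} := @dg_shift _ transfer.

End DG.

(* The ring Z[t, t^-1], as the subring of the fractions p / t^k of Q(t) *)
Definition is_laurent (x : {fraction {poly int}}) : bool :=
  `[< exists p k, x = tofrac p / tofrac 'X^k >].

Lemma is_laurent_subring : subring_closed is_laurent.
Proof.
have X0 k : tofrac 'X^k != 0 :> {fraction {poly int}}.
  by rewrite tofrac_eq0 -size_poly_eq0 size_polyXn.
split=> [|_ _ /asboolP[p [k ->]] /asboolP[q [l ->]]|
  _ _ /asboolP[p [k ->]] /asboolP[q [l ->]]]; apply/asboolP.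
- by exists 1, 0%N; rewrite expr0 !tofrac1 divr1.
- exists (p * 'X^l - q * 'X^k), (k + l)%N.
  by rewrite -mulNr addf_div// exprD tofracB !tofracM mulNr.
- by exists (p * q), (k + l)%N; rewrite exprD !tofracM mulf_div.
Qed.

HB.instance Definition _ :=
  GRing.isSubringClosed.Build _ is_laurent is_laurent_subring.

Record laurent := Laurent {
  laurent_val :> {fraction {poly int}};
  _ : laurent_val \in is_laurent }.

HB.instance Definition _ := [isSub for laurent_val].
HB.instance Definition _ := [Choice of laurent by <:].
HB.instance Definition _ := [SubChoice_isSubComNzRing of laurent by <:].

Lemma is_laurent_t : tofrac 'X \in is_laurent.
Proof. by apply/asboolP; exists 'X, 0%N; rewrite expr0 tofrac1 divr1. Qed.

Definition laurent_t : laurent := Laurent is_laurent_t.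

(* laurent_mod Tbij is the Z[t, t^-1]-module with underlying additive group V on
   which t acts as the automorphism T. *)
Section LaurentModule.
Context {V : zmodType} (T : {additive V -> V}) (Tbij : bijective T).

Definition laurent_mod of bijective T : Type := V.
Local Notation M := (laurent_mod Tbij).

HB.instance Definition _ := GRing.Zmodule.on M.

Let Tinv_ex : exists S : V -> V, cancel T S /\ cancel S T.
Proof. by case: Tbij => S TK SK; exists S. Qed.

Let Tinv : V -> V := sval (cid Tinv_ex).
Let TK : cancel T Tinv. Proof. exact: (svalP (cid Tinv_ex)).1. Qed.
Let TinvK : cancel Tinv T. Proof. exact: (svalP (cid Tinv_ex)).2. Qed.

Let act (p : {poly int}) (v : V) : V := \sum_(i < size p) iter i T v *~ p`_i.

Let iterTD k : {morph iter k T : u v / u + v}.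
Proof. by move=> u v; elim: k => //= k ->; rewrite raddfD. Qed.

Let iterTK k : cancel (iter k T) (iter k Tinv).
Proof.
by elim: k => [//|k IH] v; rewrite iterSr iterS TK IH.
Qed.

Let X0 j : tofrac 'X^j != 0 :> {fraction {poly int}}.
Proof. by rewrite tofrac_eq0 -size_poly_eq0 size_polyXn. Qed.

Let TTinv j : cancel (iter j Tinv) (iter j T).
Proof. by elim: j => [//|j IH] w; rewrite iterSr iterS TinvK IH. Qed.

Let act_wide n (p : {poly int}) v : (size p <= n)%N ->
  act p v = \sum_(i < n) iter i T v *~ p`_i.
Proof.
move=> pn; rewrite /act (big_ord_widen n (fun i => iter i T v *~ p`_i) pn).
rewrite big_mkcond; apply: eq_bigr => i _; case: ltnP => // pi.
by rewrite nth_default.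
Qed.

Let actDl p q v : act (p + q) v = act p v + act q v.
Proof.
pose n := maxn (size p) (size q).
rewrite !(@act_wide n) ?leq_maxl ?leq_maxr ?size_polyD// -big_split /=.
by apply: eq_bigr => i _; rewrite coefD mulrzDr.
Qed.

Let actDr p u v : act p (u + v) = act p u + act p v.
Proof.
by rewrite /act -big_split /=; apply: eq_bigr => i _; rewrite iterTD mulrzDl.
Qed.

Let actC c v : act c%:P v = v *~ c.
Proof. by rewrite (@act_wide 1) ?size_polyC_leq1// big_ord1 coefC. Qed.

Let act0 v : act 0 v = 0.
Proof. by rewrite /act size_poly0 big_ord0. Qed.

Let actMX p v : act (p * 'X) v = T (act p v).
Proof.
have [->|p0] := eqVneq p 0; first by rewrite mul0r act0 raddf0.
rewrite /act size_mulX// big_ord_recl coefMX /= mulr0z add0r raddf_sum.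
by apply: eq_bigr => i _; rewrite coefMX /= raddfMz.
Qed.

Let actT p v : act p (T v) = T (act p v).
Proof.
rewrite /act raddf_sum; apply: eq_bigr => i _.
by rewrite raddfMz -iterSr.
Qed.

Let actM p q v : act (p * q) v = act p (act q v).
Proof.
elim/poly_ind: p => [|p c IH]; first by rewrite mul0r !act0.
rewrite mulrDl !actDl -mulrA ['X * q]mulrC mulrA !actMX IH actC.
congr (_ + _); rewrite mul_polyC.
rewrite (@act_wide (size q)) ?size_scale_leq// /act mulrz_suml.
by apply: eq_bigr => i _; rewrite coefZ mulrC mulrzA.
Qed.

Let actXn k p v : act (p * 'X^k) v = iter k T (act p v).
Proof.
by elim: k => [|k IH]; rewrite ?expr0 ?mulr1// exprSr mulrA actMX IH.
Qed.

Let num_den (x : laurent) :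
  exists pk : {poly int} * nat, \val x = tofrac pk.1 / tofrac 'X^(pk.2).
Proof. by have /asboolP[p [k e]] := valP x; exists (p, k). Qed.

(* (p / t^k) v = T^-k (p(T) v) *)
Definition laurent_scale (x : laurent) (v : M) : M :=
  let pk := sval (cid (num_den x)) in iter pk.2 Tinv (act pk.1 v).

Let scaleE p k x v : \val x = tofrac p / tofrac 'X^k ->
  laurent_scale x v = iter k Tinv (act p v).
Proof.
rewrite /laurent_scale; case: cid => -[q l] /= -> /eqP.
rewrite eqr_div// -!tofracM tofrac_eq => /eqP e.
have {}e : iter k T (act q v) = iter l T (act p v) by rewrite -!actXn e.
apply: (can_inj (iterTK (k + l))).
rewrite ssrnat.iterD TTinv e.
by rewrite addnC ssrnat.iterD TTinv.
Qed.

Let scaleP (x : laurent) : exists p k, \val x = tofrac p / tofrac 'X^k.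
Proof. exact/asboolP/(valP x). Qed.

Let act_iterT p k v : act p (iter k T v) = iter k T (act p v).
Proof. by elim: k => //= k IH; rewrite actT IH. Qed.

Let scaleA x y v : laurent_scale x (laurent_scale y v) = laurent_scale (x * y) v.
Proof.
have [p [k ex]] := scaleP x; have [q [l ey]] := scaleP y.
rewrite (scaleE _ ex) (scaleE _ ey) (@scaleE (p * q) (k + l)%N); last first.
  by rewrite rmorphM /= ex ey mulf_div exprD !tofracM.
rewrite actM addnC ssrnat.iterD.
apply: (can_inj (iterTK (k + l))).
rewrite [in LHS]addnC ssrnat.iterD TTinv -act_iterT TTinv.
by rewrite ssrnat.iterD !TTinv.
Qed.

Let scale1 : left_id 1 laurent_scale.
Proof.
move=> v; rewrite (@scaleE 1%:P 0%N) /= ?actC ?mulr1z//.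
by rewrite expr0 !rmorph1 divr1.
Qed.

Let scaleDr : right_distributive laurent_scale +%R.
Proof.
move=> x u v; have [p [k e]] := scaleP x; rewrite !(scaleE _ e).
apply: (can_inj (iterTK k)); rewrite iterTD !TTinv; exact: actDr.
Qed.

Let scaleDl v : {morph laurent_scale^~ v : x y / x + y}.
Proof.
move=> x y; have [p [k ex]] := scaleP x; have [q [l ey]] := scaleP y.
rewrite (scaleE _ ex) (scaleE _ ey) (@scaleE (p * 'X^l + q * 'X^k) (k + l)%N).
  apply: (can_inj (iterTK (k + l))); rewrite iterTD TTinv actDl !actXn.
  by congr (_ + _); [rewrite addnC|]; rewrite ssrnat.iterD TTinv.
by rewrite rmorphD /= ex ey addf_div// exprD tofracD !tofracM.
Qed.

HB.instance Definition _ :=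
  GRing.Zmodule_isLmodule.Build laurent M scaleA scale1 scaleDr scaleDl.

Lemma laurent_mod_tE (v : M) : laurent_t *: v = T v.
Proof.
rewrite [LHS](@scaleE 'X 0%N) /=; last by rewrite expr0 tofrac1 divr1.
by rewrite -['X]mul1r -polyC1 actMX actC mulr1z.
Qed.

End LaurentModule.

(* Z as a Z[t, t^-1]-module with trivial action of t *)
Lemma idfun_bij (V : zmodType) : bijective (idfun : {additive V -> V}).
Proof. by exists idfun. Qed.

Notation trivial_int := (laurent_mod (idfun_bij int)).

(* Main.v *)
(* Write x^+, x^- for the two copies of x in the disconnection X. The map tau
   is a bijection of [0, 1[ and its left limit tl is a bijection of ]0, 1], so
   sigma, which sends x^+ to (tau x)^+ and x^- to (tl x)^-, is a homeomorphism.
   Hence L f = f o sigma^-1 is bijective and DG(tau) = C(X, Z).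

   An f in C(X, Z) is determined by its finitely many jumps f(x^+) - f(x^-) and
   its value at 0: it is a combination of the steps e_u = 1_[u^+, 1], where
   e_0 = 1. The claim is that 1 and the L^k e_(a_i), for k in Z and 0 < i < n,
   form a basis of C(X, Z).

   They span: L^-1 e_(tau x) - e_x jumps only at partition points, so e_x is in
   the span iff e_(tau x) is, and each u in the generalized orbit is linked by
   tau to some a_i. They are free: given a relation sum b_(i,k) L^k e_(a_i) = c
   with 0 <= k <= N, apply L^-N and look at the jump at the point y such that
   tau^N y = a_j. As tau^m y is not a partition point for m < N, only the term
   k = 0, i = j contributes, so b_(j,0) = 0; then divide by L and repeat. *)
Require Import Defs.
From HB Require Import structures.
From mathcomp Require Import all_boot all_order all_algebra fraction.
From mathcomp Require Import all_classical all_reals all_analysis.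
From mathcomp Require Import lra.

Set Implicit Arguments.
Unset Strict Implicit.
Unset Printing Implicit Defensive.

Import Order.TTheory GRing.Theory Num.Theory numFieldNormedType.Exports.

Local Open Scope classical_set_scope.
Local Open Scope ring_scope.

(** * Modules over the Laurent polynomials *)

(** The Laurent combinations are built as a map out of the free module, whereas the isomorphism is
    wanted in the opposite direction. *)
Lemma linear_bij_inv (A : pzRingType) (U W : lmodType A) (f : U -> W) :
  linear f -> bijective f -> exists g : {linear W -> U}, bijective g.
Proof.
move=> lf [g fK gK].
have lg : linear g by move=> x u v; rewrite -{1}[u]gK -{1}[v]gK -lf fK.
pose G : {linear W -> U} := HB.pack g (GRing.isLinear.Build A W U *:%R g lg).
by exists G, f.
Qed.

Section LaurentPolynomials.

Definition laurent_poly (p : {poly int}) : laurent :=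
  (map_poly (intr : int -> laurent) p).[laurent_t].

Lemma laurent_polyC c : laurent_poly c%:P = c%:~R.
Proof. by rewrite /laurent_poly map_polyC hornerC. Qed.

Lemma laurent_polyMXD p c :
  laurent_poly (p * 'X + c%:P) = laurent_t * laurent_poly p + c%:~R.
Proof.
rewrite /laurent_poly rmorphD rmorphM /= map_polyX map_polyC /=.
by rewrite hornerMXaddC mulrC.
Qed.

Lemma laurent_polyXnM k p :
  laurent_poly ('X^k * p) = laurent_t ^+ k * laurent_poly p.
Proof. by rewrite /laurent_poly rmorphM /= map_polyXn hornerM hornerXn. Qed.

(** Evaluation at [t] agrees with the embedding of polynomials into Q(t), so identities between
    Laurent polynomials can be checked on fractions. *)
Lemma val_laurent_poly p : \val (laurent_poly p) = tofrac p.
Proof.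
elim/poly_ind: p => [|p c IH].
  by rewrite -polyC0 laurent_polyC mulr0z tofrac0.
have vZ : \val (c%:~R : laurent) = tofrac c%:P.
  by rewrite -[in RHS](intz c) rmorph_int !(rmorph_int (@polyC int)) !rmorph_int.
by rewrite laurent_polyMXD rmorphD rmorphM /= IH vZ tofracD tofracM mulrC.
Qed.

(** Clearing denominators: together with the cancellation of [t ^ k], this reduces statements about
    Laurent scalars to polynomial ones. *)
Lemma laurent_polyP (x : laurent) :
  exists k p, laurent_t ^+ k * x = laurent_poly p.
Proof.
have /asboolP[p [k e]] := valP x; exists k, p.
have {}e : \val x * tofrac 'X^k = tofrac p.
  by rewrite e divfK// tofrac_eq0 -size_poly_eq0 size_polyXn.
by apply: val_inj; rewrite val_laurent_poly -e rmorphM rmorphXn rmorphXn mulrC.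
Qed.

Lemma laurent_tX_regular k : injective (fun x => laurent_t ^+ k * x).
Proof.
move=> x y /= /(congr1 val); rewrite !rmorphM !rmorphXn => e; apply: val_inj.
have X0 : (tofrac 'X : {fraction {poly int}}) != 0.
  by rewrite tofrac_eq0 polyX_eq0.
by apply: mulfI e; apply: expf_neq0; exact: X0.
Qed.

Lemma laurent_tV : exists s, laurent_t * s = 1.
Proof.
have sP : (tofrac 1 / tofrac 'X^1 : {fraction {poly int}}) \in is_laurent.
  by apply/asboolP; exists 1, 1%N.
have tsE : tofrac 'X * (tofrac 1 / tofrac 'X^1) = 1 :> {fraction {poly int}}.
  by rewrite mulrC expr1 divfK ?tofrac1// tofrac_eq0 polyX_eq0.
by exists (Laurent sP); apply: val_inj; rewrite rmorphM; exact: tsE.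
Qed.

End LaurentPolynomials.

Section LaurentModules.
Context (V : zmodType) (T : {additive V -> V}) (Tbij : bijective T).
Local Notation M := (laurent_mod Tbij).

Lemma laurent_scaletX k (v : M) : laurent_t ^+ k *: v = iter k T v.
Proof.
elim: k => [|k IH]; first by rewrite expr0 scale1r.
by rewrite exprS -scalerA IH laurent_mod_tE.
Qed.

Lemma laurent_tX_inj k : injective (fun v : M => laurent_t ^+ k *: v).
Proof.
move=> u v; rewrite !laurent_scaletX => e.
by elim: k e => //= k IH /(bij_inj Tbij)/IH.
Qed.

Lemma laurent_scale_int (c : int) (v : M) : (c%:~R : laurent) *: v = v *~ c.
Proof. by rewrite -scaler_int. Qed.

Lemma laurent_scale_polyMXD p c (v : M) :
  laurent_poly (p * 'X + c%:P) *: v = T (laurent_poly p *: v) + v *~ c.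
Proof.
by rewrite laurent_polyMXD scalerDl -scalerA laurent_mod_tE laurent_scale_int.
Qed.

(** [N] may exceed the degree, so that several polynomials can be expanded over one common range. *)
Lemma laurent_poly_scaleE N (p : {poly int}) (v : M) : (size p <= N)%N ->
  laurent_poly p *: v = \sum_(k < N) iter k T v *~ p`_k.
Proof.
elim: N p => [|N IH] p.
  rewrite leqn0 size_poly_eq0 => /eqP ->.
  by rewrite big_ord0 -polyC0 laurent_polyC scale0r.
have [q [c ->]] : exists q c, p = q * 'X + c%:P.
  by elim/poly_ind: p => [|q c _]; [exists 0, 0; rewrite mul0r add0r|exists q, c].
rewrite size_MXaddC; case: ifP => [/andP[/eqP -> /eqP ->] _|_ qN].
  rewrite mul0r add0r laurent_polyC scale0r big1// => i _.
  by rewrite coef0.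
rewrite laurent_scale_polyMXD IH// big_ord_recl addrC raddf_sum.
congr (_ + _); first by rewrite coefD coefMX coefC add0r.
by apply: eq_bigr => i _; rewrite raddfMz coefD coefMX coefC addr0.
Qed.

End LaurentModules.

(** Commuting with [t] gives commutation with polynomials by Horner induction; a power of [t], which
    acts injectively, then clears the denominator of [x]. *)
Lemma laurent_mod_linear (V W : zmodType) (S : {additive V -> V})
    (T : {additive W -> W}) (Sbij : bijective S) (Tbij : bijective T)
    (f : {additive V -> W}) : (forall v, f (S v) = T (f v)) ->
  forall (x : laurent) (v : laurent_mod Sbij),
    f (x *: v) = x *: (f v : laurent_mod Tbij).
Proof.
move=> fS x v.
have fp p : f (laurent_poly p *: v) = laurent_poly p *: (f v : laurent_mod Tbij).
  elim/poly_ind: p => [|p c IH].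
    by rewrite -polyC0 laurent_polyC !scale0r raddf0.
  by rewrite !laurent_scale_polyMXD raddfD fS IH raddfMz.
have [k [p e]] := laurent_polyP x.
apply: (@laurent_tX_inj _ _ Tbij k) => /=.
rewrite scalerA e -fp -e -scalerA !laurent_scaletX.
by elim: k {e} => //= k ->; rewrite fS.
Qed.

(** * The isomorphism given by a basis and a fixed vector *)

Section LaurentBasis.
Context (V : zmodType) (T : {additive V -> V}) (Tbij : bijective T).
Context (m : nat) (g : 'I_m -> V) (u : V).
Local Notation M := (laurent_mod Tbij).

Hypothesis Tu : T u = u.
Hypothesis u_free : forall c : int, u *~ c = 0 -> c = 0.
(** Generation is phrased as an induction principle, so that no explicit Laurent combination has to
    be produced. *)
Hypothesis span : forall P : V -> Prop,
  P u -> (forall i, P (g i)) -> P 0 -> (forall v w, P v -> P w -> P (v - w)) ->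
  (forall v, P (T v) <-> P v) -> forall v, P v.
(* Only the lowest coefficients are asked to vanish: as T is injective, the
   others follow by dividing by t. *)
Hypothesis low_coef0 : forall (N : nat) (b : 'I_m -> nat -> int) (c : int),
  \sum_i \sum_(k < N.+1) iter k T (g i) *~ b i k = u *~ c ->
  forall i, b i 0%N = 0.

Let comb (w : 'rV[laurent]_m * trivial_int) : M :=
  \sum_i (w.1 0 i *: (g i : M)) + (u *~ (w.2 : int) : V).

Let comb_linear : linear comb.
Proof.
move=> x v w; rewrite /comb.
pose h (c : int) : V := u *~ c.
have h_add : zmod_morphism h by move=> b c; rewrite /h mulrzBr.
pose H : {additive int -> V} := HB.pack h (GRing.isZmodMorphism.Build int V h h_add).
(* The trivial summand is respected because [T] fixes [u]: the map [c |-> u *~ c] intertwines the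
   identity with [T]. *)
have hx (c : trivial_int) : (u *~ (x *: c : int)) = x *: (h c : M).
  apply: (@laurent_mod_linear _ _ idfun T _ Tbij H) => c'.
  by rewrite /= /h raddfMz Tu.
rewrite mulrzDr hx scalerDr scaler_sumr addrACA; congr (_ + _).
rewrite -big_split; apply: eq_bigr => i _ /=.
by rewrite !mxE scalerDl scalerA.
Qed.

(** Induction on the degree bound: the constant terms vanish by [low_coef0], and dividing every
    polynomial by [t] lowers the bound. *)
Let poly_free N (p : 'I_m -> {poly int}) (c : int) :
  (forall i, size (p i) <= N)%N ->
  \sum_i laurent_poly (p i) *: (g i : M) = u *~ c -> forall i, p i = 0.
Proof.
elim: N p => [|N IH] p pN e i.
  by apply/eqP; rewrite -size_poly_eq0 -leqn0.
have p0 j : (p j)`_0 = 0.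
  apply: (@low_coef0 N (fun j k => (p j)`_k) c); rewrite -e.
  by apply: eq_bigr => {}j _; rewrite (laurent_poly_scaleE (g j : M) (pN j)).
pose q j := drop_poly 1 (p j).
have pE j : p j = q j * 'X + 0%:P.
  rewrite addr0 -[LHS](poly_take_drop 1) expr1 (_ : take_poly 1 _ = 0) ?add0r//.
  by apply/polyP => -[|k]; rewrite coef_take_poly coef0 /= ?p0.
have qN j : (size (q j) <= N)%N.
  by rewrite size_drop_poly leq_subLR add1n.
have q0 j : q j = 0.
  (* Applying [T] turns the [q j] back into the [p j] and fixes [u], so the divided relation holds
     with the same [c]. *)
  apply: (IH q qN); apply: (bij_inj Tbij).
  rewrite raddfMz Tu -e raddf_sum; apply: eq_bigr => k _.
  by rewrite [in RHS]pE laurent_scale_polyMXD mulr0z addr0.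
by rewrite pE q0 mul0r add0r.
Qed.

Let comb_eq0 w : comb w = 0 -> w = 0.
Proof.
case: w => r c; rewrite /comb /= => e.
have /choice[k /choice[p kpE]] i :
    exists k p, laurent_t ^+ k * r 0 i = laurent_poly p by exact: laurent_polyP.
(* A crude common exponent that clears all denominators at once; the sum of the sizes serves below
   as a common degree bound. *)
pose K := (\sum_i k i)%N.
have kK i : (k i <= K)%N by rewrite /K (bigD1 i)//= leq_addr.
pose q i := 'X^(K - k i) * p i.
have qE i : laurent_t ^+ K * r 0 i = laurent_poly (q i).
  by rewrite laurent_polyXnM -kpE mulrA -exprD subnK.
have q0 : forall i, q i = 0.
  apply: (@poly_free (\sum_i size (q i)) q (- c)) => [i|].
    by rewrite (bigD1 i)//= leq_addr.
  have := congr1 (fun v : M => laurent_t ^+ K *: v) e.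
  rewrite /= scaler0 scalerDr (laurent_scaletX K (u *~ c : M)).
  have -> : iter K T (u *~ c) = u *~ c.
    by elim: {kK q qE e}K => //= j IH; rewrite IH raddfMz Tu.
  move=> /eqP; rewrite addr_eq0 -mulrNz => /eqP; apply: etrans.
  by rewrite scaler_sumr; apply: eq_bigr => i _; rewrite scalerA qE.
have r0 i : r 0 i = 0.
  apply: (@laurent_tX_regular K); rewrite qE q0 mulr0.
  by rewrite -polyC0 laurent_polyC.
have -> : r = 0 by apply/rowP => i; rewrite r0 mxE.
suff -> : c = 0 by [].
by apply: u_free; move: e; rewrite big1 ?add0r// => i _; rewrite r0 scale0r.
Qed.

(** The range of [comb] is a subgroup stable under [t] and its inverse, so the induction principle
    [span] applies to it. *)
Let comb_surj v : exists w, comb w = v.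
Proof.
have combB w w' : comb (w - w') = comb w - comb w'.
  by rewrite -scaleN1r addrC comb_linear scaleN1r addrC.
have combt x w : comb (x *: w) = x *: comb w.
  have c0 : comb 0 = 0 by rewrite -[X in comb X](subrr 0) combB subrr.
  by rewrite -[x *: w]addr0 comb_linear c0 addr0.
move: v; apply: span => [|i||_ _ [v <-] [w <-]|v].
- exists (0, 1 : int); rewrite /comb /= mulr1z big1 ?add0r// => i _.
  by rewrite mxE scale0r.
- exists (delta_mx 0 i, 0 : int); rewrite /comb /= mulr0z addr0.
  rewrite (bigD1 i)//= mxE !eqxx scale1r big1 ?addr0// => j ji.
  by rewrite mxE eqxx (negbTE ji) scale0r.
- by exists 0; rewrite -[X in comb X](subrr 0) combB subrr.
- by exists (v - w); rewrite combB.
- have [s ts] := laurent_tV.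
  split=> -[w wE]; [exists (s *: w)|exists (laurent_t *: w)].
    by rewrite combt wE -(laurent_mod_tE (v : M)) scalerA mulrC ts scale1r.
  by rewrite combt wE laurent_mod_tE.
Qed.

Lemma laurent_basis_iso :
  exists phi : {linear M -> ('rV[laurent]_m * trivial_int)%type}, bijective phi.
Proof.
apply: (linear_bij_inv comb_linear).
have /choice[f fK] := comb_surj; exists f => // w.
apply/eqP; rewrite -subr_eq0; apply/eqP/comb_eq0.
by rewrite -scaleN1r addrC comb_linear fK scaleN1r addNr.
Qed.

End LaurentBasis.

(** * Interval exchange maps *)

Definition left_limit (R : realType) (tau : R -> R) (x : R) : R :=
  lim (tau y @[y --> x^'-]).

Section IntervalExchange.
Context (R : realType) (tau : R -> R) (n : nat) (a : nat -> R).
Hypothesis tau_iem : interval_exchange tau n a.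
Local Notation tl := (left_limit tau).

Lemma partition_first : a 0 = 0.
Proof. by case: tau_iem => -[_ []]. Qed.

Lemma partition_last : a n = 1.
Proof. by case: tau_iem => -[_ []]. Qed.

Lemma partition_lt i j : (i < j)%N -> (j <= n)%N -> a i < a j.
Proof.
have [[_ [_ _ aS] _] _ _ _ _] := tau_iem.
elim: j => // j IH; rewrite ltnS leq_eqVlt => /predU1P[->|ij] jn; first exact: aS.
by apply: lt_trans (IH ij (ltnW jn)) _; exact: aS.
Qed.

Lemma partition_le i j : (i <= j)%N -> (j <= n)%N -> a i <= a j.
Proof.
by rewrite leq_eqVlt => /predU1P[->//|ij] jn; rewrite ltW// partition_lt.
Qed.

Lemma partition_bound i : (i <= n)%N -> 0 <= a i <= 1.
Proof. by move=> ni; rewrite -partition_first -partition_last !partition_le. Qed.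

Lemma partition_inj i j : (i <= n)%N -> (j <= n)%N -> a i = a j -> i = j.
Proof.
move=> ni nj aij; case: (ltngtP i j) => // ij.
  by have := partition_lt ij nj; rewrite aij ltxx.
by have := partition_lt ij ni; rewrite aij ltxx.
Qed.

Lemma partition_right x : 0 <= x < 1 -> exists2 i, (i < n)%N & a i <= x < a i.+1.
Proof.
rewrite -partition_first -[1]partition_last => /andP[x0].
elim: n => [|m IH]; first by rewrite ltNge x0.
have [xm _|mx xm] := ltP x (a m); last by exists m => //; rewrite mx.
by have [i im xi] := IH xm; exists i => //; exact: ltnW.
Qed.

Lemma partition_left x : 0 < x <= 1 -> exists2 i, (i < n)%N & a i < x <= a i.+1.
Proof.
rewrite -partition_first -[1]partition_last => /andP[x0].
elim: n => [|m IH]; first by rewrite leNgt x0.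
have [xm _|mx xm] := leP x (a m); last by exists m => //; rewrite mx.
by have [i im xi] := IH xm; exists i => //; exact: ltnW.
Qed.

(** No partition point lies strictly between [x] and [y]. Both ends may be partition points: [tau]
    is then used on [x, y[ and its left limits on ]x, y]. *)
Definition in_piece x y := exists2 i, (i < n)%N & [/\ a i <= x, x < y & y <= a i.+1].

Lemma in_pieceW x y x' y' : in_piece x y -> x <= x' -> x' < y' -> y' <= y -> in_piece x' y'.
Proof.
move=> [i ni [aix xy yai]] xx' xy' y'y; exists i => //; split=> //; first exact: le_trans xx'.
exact: le_trans yai.
Qed.

Lemma in_piece_bound x y : in_piece x y -> [/\ 0 <= x, x < y & y <= 1].
Proof.
move=> [i ni [aix xy yai]]; have /andP[a0 _] := partition_bound (ltnW ni).
have /andP[_ a1] := partition_bound ni.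
by split=> //; [exact: le_trans aix|exact: le_trans a1].
Qed.

Lemma tau_continuous x y z : in_piece x y -> x < z < y -> tau z' @[z' --> z] --> tau z.
Proof.
move=> [i ni [aix xy yai]] /andP[xz zy].
have [[_ _ /(_ _ ni)[+ _]] _ _ _ _] := tau_iem; apply.
by rewrite in_itv/= (le_lt_trans aix)//= (lt_le_trans zy).
Qed.

Lemma tau_right_continuous x : 0 <= x < 1 -> tau y @[y --> x^'+] --> tau x.
Proof. by case: tau_iem => _ _ _ + _ => /(_ x); rewrite in_itv; apply. Qed.

(** Monotonicity is given on open pieces only; right continuity carries it to the left end [x]. *)
Lemma tau_lt x y z w : in_piece x y -> x <= z -> z < w -> w < y -> tau z < tau w.
Proof.
move=> xyp xz zw wy.
have openlt u v : x < u -> u < v -> v < y -> tau u < tau v.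
  move=> xu uv vy; case: xyp => i ni [aix _ yai].
  have [_ + _ _ _] := tau_iem; move/(_ _ ni); apply=> //; rewrite in_itv/=.
    by rewrite (le_lt_trans aix)//= (lt_trans uv)// (lt_le_trans vy).
  by rewrite (le_lt_trans aix)//= ?(lt_le_trans vy)// (lt_trans xu).
move: xz; rewrite le_eqVlt => /predU1P[xz|xz]; last exact: openlt.
rewrite -{z}xz in zw *.
have [x0 _ y1] := in_piece_bound xyp.
have c := @tau_right_continuous x.
(* Passing to the limit only gives a weak inequality; an intermediate point keeps the final one
   strict. *)
pose m := (x + w) / 2.
have [xm mw] : x < m /\ m < w by rewrite /m; split; lra.
apply: (@le_lt_trans _ _ (tau m)); last exact: openlt.
have {}c : tau y @[y --> x^'+] --> tau x.
  by apply: c; rewrite x0 (lt_le_trans _ y1)// (lt_trans xm)// (lt_trans mw).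
apply: (@cvgr_to_le _ _ _ _ _ _ _ c).
near=> u; apply/ltW/openlt.
- by near: u; exact: nbhs_right_gt.
- by near: u; exact: nbhs_right_lt.
- by apply: lt_trans wy.
Unshelve. all: by end_near. Qed.


Lemma tau_itv x : 0 <= x < 1 -> 0 <= tau x < 1.
Proof.
have [_ _ [fun_tau _ _] _ _] := tau_iem.
by move=> x01; have := fun_tau x; rewrite /= !in_itv; apply.
Qed.

Lemma tau_inj x y : 0 <= x < 1 -> 0 <= y < 1 -> tau x = tau y -> x = y.
Proof.
have [_ _ [_ inj_tau _] _ _] := tau_iem.
by move=> x01 y01 ?; apply: inj_tau => //; rewrite inE/= in_itv.
Qed.

Lemma tau_surj y : 0 <= y < 1 -> exists2 x, 0 <= x < 1 & tau x = y.
Proof.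
have [_ _ [_ _ surj_tau] _ _] := tau_iem.
move=> y01; have [|x /= x01 <-] := surj_tau y; first by rewrite /= in_itv.
by exists x => //; move: x01; rewrite in_itv.
Qed.

Lemma in_piece_ends i : (i < n)%N -> in_piece (a i) (a i.+1).
Proof. by move=> ni; exists i => //; split=> //; exact: partition_lt. Qed.

Lemma in_piece_left x : 0 < x <= 1 -> exists y, in_piece y x.
Proof.
move=> /partition_left[i ni /andP[ax xa]]; exists (a i).
by apply: in_pieceW (in_piece_ends ni) _ _ _.
Qed.

Lemma in_piece_right x : 0 <= x < 1 -> exists y, in_piece x y.
Proof.
move=> /partition_right[i ni /andP[ax xa]]; exists (a i.+1).
by apply: in_pieceW (in_piece_ends ni) _ _ _.
Qed.

(** Just to the left of [x] the map is increasing and bounded by 1, so the limit exists. *)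
Lemma tau_left_cvg x : 0 < x <= 1 -> tau y @[y --> x^'-] --> tl x.
Proof.
move=> /in_piece_left[y yx]; have [y0 ltyx x1] := in_piece_bound yx.
apply: nondecreasing_at_left_is_cvgr; near=> u.
  have yu : y < u by near: u; exact: nbhs_left_gt.
  move=> v w; rewrite !in_itv/= => /andP[uv vx] /andP[uw wx].
  rewrite le_eqVlt => /predU1P[->//|vw]; rewrite ltW//.
  by apply: tau_lt yx _ vw wx; rewrite ltW// (lt_trans yu).
have yu : y < u by near: u; exact: nbhs_left_gt.
exists 1 => _ [v /= + <-]; rewrite in_itv/= => /andP[uv vx].
suff /andP[_ /ltW] : 0 <= tau v < 1 by [].
by apply: tau_itv; rewrite (le_trans y0)/= ?(lt_le_trans vx)// ltW// (lt_trans yu).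
Unshelve. all: by end_near. Qed.

Lemma left_limit_unique x l : 0 < x <= 1 -> tau y @[y --> x^'-] --> l -> tl x = l.
Proof. by move=> _ /cvg_lim; apply. Qed.

Lemma right_limit_unique x l : 0 <= x < 1 -> tau y @[y --> x^'+] --> l -> tau x = l.
Proof.
by move=> /tau_right_continuous c /(cvg_lim (@Rhausdorff R)) <-; rewrite (cvg_lim _ c).
Qed.

Lemma left_limitE x y z : in_piece x y -> x < z < y -> tl z = tau z.
Proof.
move=> xy xzy; apply/cvg_lim => //.
by apply: cvg_at_left_filter; exact: tau_continuous xy xzy.
Qed.

Lemma tau_lt_left_limit x y z w :
  in_piece x y -> x <= z -> z < w -> w <= y -> tau z < tl w.
Proof.
move=> xy xz zw wy; have [x0 _ y1] := in_piece_bound xy.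
pose m := (z + w) / 2.
have [zm mw] : z < m /\ m < w by rewrite /m; split; lra.
apply: (@lt_le_trans _ _ (tau m)); first by apply: tau_lt xy xz zm _; exact: lt_le_trans wy.
have w01 : 0 < w <= 1.
  by rewrite (le_lt_trans x0) ?(le_lt_trans xz)//= (le_trans wy).
apply: (@cvgr_to_ge _ _ _ _ _ _ _ (tau_left_cvg w01)).
near=> u; rewrite ltW//; apply: (tau_lt xy).
- by rewrite ltW// (le_lt_trans xz).
- by near: u; exact: nbhs_left_gt.
- by apply: lt_le_trans wy; near: u; exact: nbhs_left_lt.
Unshelve. all: by end_near. Qed.

Lemma left_limit_lt x y z w :
  in_piece x y -> x < z -> z < w -> w <= y -> tl z < tl w.
Proof.
move=> xy xz zw wy; rewrite (left_limitE xy) ?xz ?(lt_le_trans zw)//.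
by apply: tau_lt_left_limit xy _ zw wy; exact: ltW.
Qed.

Lemma left_limit_itv x : 0 < x <= 1 -> 0 < tl x <= 1.
Proof.
move=> x01; have [y yx] := in_piece_left x01.
have [y0 ltyx x1] := in_piece_bound yx.
have /andP[ty0 _] : 0 <= tau y < 1 by apply: tau_itv; rewrite y0 (lt_le_trans ltyx).
rewrite (le_lt_trans ty0) ?(tau_lt_left_limit yx)//=.
apply: (@cvgr_to_le _ _ _ _ _ _ _ (tau_left_cvg x01)).
near=> u; suff /andP[_ /ltW] : 0 <= tau u < 1 by [].
apply: tau_itv; rewrite (@lt_le_trans _ _ x)// ?andbT.
  by rewrite (le_trans y0)// ltW//; near: u; exact: nbhs_left_gt.
Unshelve. all: by end_near. Qed.

Lemma left_limit_near x v r : 0 < x <= 1 -> v < tl x -> r < x ->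
  exists2 y, in_piece y x & r < y /\ v < tau y.
Proof.
move=> x01 vx rx; have [z zx] := in_piece_left x01.
have [z0 ltzx _] := in_piece_bound zx.
near (x^'-) => y; exists y.
  apply: in_pieceW zx _ _ (lexx _); last by near: y; exact: nbhs_left_lt.
  by near: y; exact: nbhs_left_ge.
split; first by near: y; exact: nbhs_left_gt.
by near: y; exact: (cvgr_gt _ (tau_left_cvg x01)).
Unshelve. all: by end_near. Qed.

Lemma tau_near x v r : 0 <= x < 1 -> tau x < v -> x < r ->
  exists2 y, in_piece x y & y < r /\ tl y < v.
Proof.
move=> x01 vx rx; have [z xz] := in_piece_right x01.
have [_ ltxz _] := in_piece_bound xz.
near (x^'+) => y.
have xy : x < y by near: y; exact: nbhs_right_gt.
have yz : y < z by near: y; exact: nbhs_right_lt.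
exists y; first exact: in_pieceW xz _ _ (ltW yz).
split; first by near: y; exact: nbhs_right_lt.
rewrite (left_limitE xz) ?xy//.
by near: y; exact: (cvgr_lt _ (tau_right_continuous x01)).
Unshelve. all: by end_near. Qed.

(** The value of [tau] at [y] may differ from its left limit, so the intermediate value theorem is
    applied on [x, z] for some z < y with tau z > u. *)
Lemma tau_ivt x y u : in_piece x y -> tau x <= u < tl y ->
  exists2 z, x <= z < y & tau z = u.
Proof.
move=> xy /andP[xu uy]; have [x0 ltxy y1] := in_piece_bound xy.
have y01 : 0 < y <= 1 by rewrite (le_lt_trans x0).
have [z zy [xz uz]] := left_limit_near y01 uy ltxy.
have [_ ltzy _] := in_piece_bound zy.
have /(IVT (ltW xz)) : {within `[x, z], continuous tau}.
  apply/(continuous_within_itvP _ xz); split.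
  - move=> w; rewrite in_itv/= => /andP[xw wz].
    by apply: tau_continuous xy _; rewrite xw (lt_trans wz).
  - by apply: tau_right_continuous; rewrite x0 (lt_le_trans ltxy).
  - apply: cvg_at_left_filter; apply: tau_continuous xy _.
    by rewrite xz.
move=> /(_ u)[|w]; first by rewrite ge_min xu le_max (ltW uz) orbT.
rewrite in_itv/= => /andP[xw wz] wu; exists w => //.
by rewrite xw (le_lt_trans wz).
Qed.

Lemma left_limit_ivt x y u : in_piece x y -> tau x < u <= tl y ->
  exists2 z, x < z <= y & tl z = u.
Proof.
move=> xy /andP[xu]; have [x0 ltxy y1] := in_piece_bound xy.
rewrite le_eqVlt => /predU1P[->|uy]; first by exists y => //; rewrite ltxy lexx.
have [|z /andP[+ zy] zu] := tau_ivt xy (u := u); first by rewrite ltW.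
rewrite le_eqVlt => /predU1P[xz|xz]; first by rewrite -zu -xz ltxx in xu.
by exists z; rewrite ?xz 1?ltW// (left_limitE xy)// xz.
Qed.

(** If two left limits agreed, [tau] would take a common value just to the left of each of the two
    points, on disjoint intervals, against its injectivity. *)
Lemma left_limit_inj x y : 0 < x <= 1 -> 0 < y <= 1 -> tl x = tl y -> x = y.
Proof.
wlog xy : x y / x < y.
  move=> W x01 y01 e; have [xy|yx|//] := ltgtP x y; first exact: W.
  by apply/esym/W.
move=> x01 y01 e; exfalso.
have [x' x'x] := in_piece_left x01.
(* If no partition point separated [x] from [y], both would lie in one piece, where left limits are
   strictly increasing. *)
have [y' [y'y xy']] : exists y', in_piece y' y /\ x <= y'.
  have [j nj /andP[ay ya]] := partition_left y01.
  have yp : in_piece (a j) y by apply: in_pieceW (in_piece_ends nj) _ _ _.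
  have [xa|ax] := leP x (a j); first by exists (a j).
  by have := left_limit_lt yp ax xy (lexx _); rewrite e ltxx.
have [x'0 ltx'x x1] := in_piece_bound x'x.
have [y'0 lty'y y1] := in_piece_bound y'y.
have l1 := tau_lt_left_limit x'x (lexx _) ltx'x (lexx _).
have l2 := tau_lt_left_limit y'y (lexx _) lty'y (lexx _).
pose u := Num.max (tau x') (tau y').
have [|z /andP[xz zx] zu] := tau_ivt x'x (u := u).
  by rewrite /u le_max lexx/= gt_max l1 e l2.
have [|w /andP[yw wy] wu] := tau_ivt y'y (u := u).
  by rewrite /u le_max lexx orbT/= gt_max l2 -e l1.
have zw : z = w.
  apply: tau_inj; rewrite ?zu//.
    by rewrite (le_trans x'0)// (lt_le_trans zx).
  by rewrite (le_trans y'0)// (lt_le_trans wy).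
by have := lt_le_trans zx (le_trans xy' yw); rewrite zw ltxx.
Qed.

(** Among the pieces whose initial value is below [u], the one with the largest initial value must
    reach [u]; the intermediate value theorem then applies. *)
Lemma left_limit_surj u : 0 < u <= 1 -> exists2 x, 0 < x <= 1 & tl x = u.
Proof.
move=> /andP[u0 u1].
(* The piece containing the preimage of 0 starts at a value at most 0, which is below [u]. *)
have [i0 ti0] : exists i0 : 'I_n, tau (a i0) < u.
  have [|z z01 tz] := tau_surj (y := 0); first by rewrite lexx ltr01.
  have [i ni /andP[az za]] := partition_right z01.
  exists (Ordinal ni) => /=; apply: le_lt_trans u0; rewrite -tz.
  move: az; rewrite le_eqVlt => /predU1P[->//|az].
  by rewrite ltW//; apply: tau_lt (in_piece_ends ni) _ az za.
case: (@arg_maxP _ R 'I_n i0 (fun i => tau (a i) < u) (fun i => tau (a i)) ti0).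
move=> i ti imax.
have [ut|tu] := leP u (tl (a i.+1)).
  have [|z /andP[az za] tz] := left_limit_ivt (in_piece_ends (ltn_ord i)) (u := u).
    by rewrite ti ut.
  have [] := in_piece_bound (in_piece_ends (ltn_ord i)) => a0 _ a1.
  by exists z => //; rewrite (le_lt_trans a0)// (le_trans za).
exfalso.
have ai01 : 0 < a i.+1 <= 1.
  have [a0 a01 a1] := in_piece_bound (in_piece_ends (ltn_ord i)).
  by rewrite a1 (le_lt_trans a0).
(* The value where piece [i] stops is attained in some piece [j]. By maximality [j] starts no higher
   than [i], so it also attains [tau (a i)]; injectivity forces i = j, yet piece [j] extends beyond
   that value. *)
have [|z z01 tz] := tau_surj (y := tl (a i.+1)).
  have /andP[t0 _] := left_limit_itv ai01.
  by rewrite (ltW t0) (lt_le_trans tu).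
have [j nj /andP[az za]] := partition_right z01.
have tjz : tau (a j) <= tl (a i.+1).
  rewrite -tz; move: az; rewrite le_eqVlt => /predU1P[->//|az].
  by rewrite ltW//; apply: tau_lt (in_piece_ends nj) _ az za.
have tji : tau (a j) <= tau (a i) by apply: (imax (Ordinal nj)) => /=; exact: le_lt_trans tu.
have ip := in_piece_ends (ltn_ord i).
have jp := in_piece_ends nj.
have [a0 a01 a1] := in_piece_bound ip.
have tii := tau_lt_left_limit ip (lexx _) a01 (lexx _).
have tz' : tl (a i.+1) < tl (a j.+1) by rewrite -tz; apply: tau_lt_left_limit jp az za _.
have [|w /andP[aw wa] tw] := tau_ivt jp (u := tau (a i)).
  by rewrite tji (lt_trans tii).
have aj01 := partition_bound nj.
have wi : w = a i.
  apply: tau_inj tw; last by rewrite a0 (lt_le_trans a01).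
  have [aj0 _ aj1] := in_piece_bound jp.
  by rewrite (le_trans aj0)// (lt_le_trans wa).
have ij : i = j :> nat.
  have [ij|ji|//] := ltngtP i j.
    by have := lt_le_trans (partition_lt ij (ltnW nj)) aw; rewrite wi ltxx.
  by have := lt_le_trans wa (partition_le ji (ltnW (ltn_ord i))); rewrite wi ltxx.
by rewrite ij ltxx in tz'.
Qed.

(** A preimage of the left limit interior to a piece would have the same left limit as [a i.+1],
    hence equal this partition point, which is interior to no piece. *)
Lemma left_limit_end i : (i < n)%N ->
  tl (a i.+1) = 1 \/ exists2 j, (j < n)%N & tl (a i.+1) = tau (a j).
Proof.
move=> ni; have ip := in_piece_ends ni; have [a0 a01 a1] := in_piece_bound ip.
have ai01 : 0 < a i.+1 <= 1 by rewrite a1 (le_lt_trans a0).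
have /andP[t0] := left_limit_itv ai01.
rewrite le_eqVlt => /predU1P[->|t1]; [by left|right].
have [|z z01 tz] := tau_surj (y := tl (a i.+1)); first by rewrite ltW.
have [j nj /andP[az za]] := partition_right z01; exists j => //.
move: az; rewrite le_eqVlt => /predU1P[->//|az]; exfalso.
have zE : z = a i.+1.
  apply: left_limit_inj => //.
    by have [aj0 _ aj1] := in_piece_bound (in_piece_ends nj);
      rewrite (le_lt_trans aj0)// ltW//; case/andP: z01.
  by rewrite -tz; apply: left_limitE (in_piece_ends nj) _; rewrite az.
rewrite zE in az za.
have ji : (j < i.+1)%N.
  by rewrite ltnNge; apply/negP => /partition_le/(_ (ltnW nj)); rewrite leNgt az.
have ij : (i.+1 < j.+1)%N.
  by rewrite ltnNge; apply/negP => /partition_le/(_ ni); rewrite leNgt za.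
by move: ij; rewrite ltnS ltnNge -ltnS ji.
Qed.

(** * The generalized orbit *)

Local Notation C := (a @` [set i | (i <= n)%N]).
Local Notation D := (generalized_orbit tau C).

Lemma left_limit_continuity x : 0 < x < 1 -> ~ C x -> tl x = tau x.
Proof.
move=> /andP[x0 x1] nCx; have [|i ni /andP[ax xa]] := @partition_right x.
  by rewrite ltW.
apply: left_limitE (in_piece_ends ni) _; rewrite xa andbT lt_neqAle ax andbT.
by apply/eqP => aix; apply: nCx; exists i => //; exact: ltnW.
Qed.

(** The multivalued map is replaced by two honest functions, [tau] and its left limit. *)
Lemma limitsP x y : limits tau x y <->
  (0 < x <= 1 /\ y = tl x) \/ (0 <= x < 1 /\ y = tau x).
Proof.
split=> [[[x0 x1 c]|[x0 x1 c]]|[[x01 ->]|[x01 ->]]].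
- by left; rewrite x0 x1; split=> //; apply/esym/left_limit_unique => //; rewrite x0.
- by right; rewrite x0 x1; split=> //; apply/esym/right_limit_unique => //; rewrite x0.
- by left; case/andP: (x01) => ? ?; split=> //; exact: tau_left_cvg.
- by right; case/andP: (x01) => ? ?; split=> //; exact: tau_right_continuous.
Qed.

Lemma orbit_partition i : (i <= n)%N -> D (a i).
Proof. by move=> ni A [_]; apply; exists i. Qed.

Lemma orbit_limits x y : 0 <= x <= 1 -> limits tau x y -> D y <-> D x.
Proof.
move=> x01 xy; split=> Dz A AP; have Az := Dz A AP; case: AP => -[_ iA pA] _.
  by apply: pA; split; [rewrite /= in_itv|exists y].
by apply: iA; exists x.
Qed.

Lemma orbit_tau x : 0 <= x < 1 -> D (tau x) <-> D x.
Proof.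
move=> x01; apply: orbit_limits; first by case/andP: x01 => -> /ltW ->.
by apply/limitsP; right.
Qed.

Lemma orbit_left_limit x : 0 < x <= 1 -> D (tl x) <-> D x.
Proof.
move=> x01; apply: orbit_limits; first by case/andP: x01 => /ltW -> ->.
by apply/limitsP; left.
Qed.

(** The points described form a set that contains the partition and is stable, both ways, under
    [tau] and under left limits; minimality of the generalized orbit concludes. *)
Lemma orbit_sub x : D x -> 0 <= x <= 1 /\ (x < 1 ->
  exists i p q, (i < n)%N /\ iter p tau x = iter q tau (a i)).
Proof.
(* The point 1 is exempt from the second clause: it lies outside the interval on which [tau] is
   bijective. *)
pose E := [set x | 0 <= x <= 1 /\ (x < 1 ->
  exists i p q, (i < n)%N /\ iter p tau x = iter q tau (a i))].
have CE : C `<=` E.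
  move=> _ [i /= ni <-]; split; first exact: partition_bound.
  move=> ai1; exists i, 0%N, 0%N; split=> //; rewrite ltn_neqAle ni andbT.
  by apply/eqP => ini; rewrite ini partition_last ltxx in ai1.
have tauE y : 0 <= y < 1 -> E (tau y) <-> E y.
  move=> /[dup] y01 /andP[y0 y1]; have /andP[ty0 ty1] := tau_itv y01.
  rewrite /E /= y0 (ltW y1) ty0 (ltW ty1); split=> -[_ yE]; split=> // _.
    by have [i [p [q [ni e]]]] := yE ty1; exists i, p.+1, q; rewrite iterSr.
  by have [i [p [q [ni e]]]] := yE y1; exists i, p, q.+1; rewrite -iterSr/= e.
have tlE y : 0 < y <= 1 -> E (tl y) <-> E y.
  (* At a partition point the left limit is 1 or a value of [tau] at a partition point, so both
     sides lie in [E]; elsewhere the left limit is [tau y]. *)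
  move=> /andP[y0 y1]; have [[i /= ni iy]|nCy] := pselect (C y).
    split=> _; first by apply: CE; exists i.
    case: i => [|i] in ni iy *; first by rewrite -iy partition_first ltxx in y0.
    rewrite -iy; have [->|[j nj ->]] := left_limit_end ni.
      by apply: CE; exists n => //=; exact: partition_last.
    apply/tauE; last by apply: CE; exists j => //; exact: ltnW.
    by have [-> ? ?] := in_piece_bound (in_piece_ends nj); rewrite (@lt_le_trans _ _ (a j.+1)).
  have {}y1 : y < 1.
    rewrite lt_neqAle y1 andbT; apply/eqP => y1'; apply: nCy.
    by exists n => //=; rewrite partition_last.
  by rewrite left_limit_continuity ?y0//; apply: tauE; rewrite ltW.
suff: D `<=` E by apply.
apply: smallest_sub CE; split.
- by move=> y [y01 _]; rewrite /= in_itv.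
- move=> y [z Ez /limitsP[[z01 ->]|[z01 ->]]]; first exact/tlE.
  exact/tauE.
- move=> z [_ [y [/limitsP[[z01 ->]|[z01 ->]]]]]; first by move/tlE; apply.
  by move/tauE; apply.
Qed.

Lemma iter_tau_itv k x : 0 <= x < 1 -> 0 <= iter k tau x < 1.
Proof. by move=> x01; elim: k => //= k IH; exact: tau_itv. Qed.

Lemma iter_tau_inj k x y : 0 <= x < 1 -> 0 <= y < 1 ->
  iter k tau x = iter k tau y -> x = y.
Proof.
move=> x01 y01; elim: k => //= k IH /tau_inj e; apply/IH/e; exact: iter_tau_itv.
Qed.

Lemma iter_tau_surj k y : 0 <= y < 1 -> exists2 x, 0 <= x < 1 & iter k tau x = y.
Proof.
elim: k y => [|k IH] y y01; first by exists y.
by have [z /IH[x x01 <-] <-] := tau_surj y01; exists x.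
Qed.

(** Each triple (i, p, q) accounts for at most one point, since the iterates of [tau] are
    injective. *)
Lemma countable_orbit : countable (D `&` `[0, 1[).
Proof.
pose B (ipq : nat * nat * nat) := [set x | 0 <= x < 1 /\
  iter ipq.1.2 tau x = iter ipq.2 tau (a ipq.1.1)].
apply: (@sub_countable _ _ _ (\bigcup_(ipq in setT) B ipq)).
  apply: subset_card_le => x [/orbit_sub[_ +]]; rewrite /= in_itv/= => + x01.
  have /andP[_ x1] := x01; move=> /(_ x1)[i [p [q [ni e]]]].
  by exists (i, p, q).
apply: bigcup_countable => // -[[i p] q] _.
have [->|/set0P[x [x01 xe]]] := eqVneq (B (i, p, q)) set0; first exact: countable0.
apply: (@sub_countable _ _ _ [set x]) => //.
apply: subset_card_le => y [y01 ye]; apply: (@iter_tau_inj p) => //.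
by rewrite xe ye.
Qed.

(** An open interval contained in the generalized orbit would be countable, hence of Lebesgue
    measure zero. *)
Lemma orbit_codense x y : 0 <= x -> x < y -> y <= 1 -> exists2 z, x < z < y & ~ D z.
Proof.
move=> x0 xy y1; apply: contrapT => nz.
have xyD : `]x, y[ `<=` D `&` `[0, 1[.
  move=> z /=; rewrite !in_itv/= => /andP[xz zy]; split.
    by apply: contrapT => nDz; apply: nz; exists z; rewrite ?xz.
  by rewrite (le_trans x0 (ltW xz)) (lt_le_trans zy).
have := countable_lebesgue_measure0 (sub_countable (subset_card_le xyD) countable_orbit).
rewrite lebesgue_measure_itv/= lte_fin xy -EFinB => -[/eqP].
by rewrite subr_eq0 => /eqP yx; rewrite yx ltxx in xy.
Qed.

End IntervalExchange.

(** * The disconnection *)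

(* Cousin's lemma, by the supremum of the x such that P 0 x. *)
Lemma cousin (R : realType) (P : R -> R -> Prop) :
  (forall x y z, 0 <= x -> x < y -> y < z -> z <= 1 -> P x y -> P y z -> P x z) ->
  (forall x, 0 <= x < 1 -> exists2 r, x < r <= 1 & forall z, x < z <= r -> P x z) ->
  (forall x, 0 < x <= 1 -> exists2 r, 0 <= r < x & forall z, r <= z < x -> P z x) ->
  P 0 1.
Proof.
move=> trans right left.
pose S := [set x | 0 < x <= 1 /\ P 0 x].
have [|r /andP[r0 r1] Pr] := right 0; first by rewrite lexx ltr01.
have Sr : S r by split; [rewrite r0|apply: Pr; rewrite r0 lexx].
have S1 : ubound S 1 by move=> x [/andP[]].
have hS : has_sup S by split; [exists r|exists 1].
have s0 : 0 < sup S by apply: lt_le_trans r0 _; exact: (ub_le_sup hS.2).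
have s1 : sup S <= 1 by apply: ge_sup => //; exists r.
have Ps : P 0 (sup S).
  have [|q /andP[q0 qs] Pq] := left (sup S); first by rewrite s0.
  have [x Sx qx] := sup_gt hS.1 qs.
  have xs : x <= sup S by exact: (ub_le_sup hS.2).
  move: xs; rewrite le_eqVlt => /predU1P[<-|xs]; first by case: Sx.
  case: Sx => /andP[x0 x1] Px; apply: (trans 0 x (sup S)) => //.
  by apply: Pq; rewrite (ltW qx).
move: s1; rewrite le_eqVlt => /predU1P[<-//|s1]; exfalso.
have [|q /andP[sq q1] Pq] := right (sup S); first by rewrite (ltW s0).
have /(ub_le_sup hS.2) : S q.
  split; first by rewrite (lt_trans s0).
  by apply: (trans 0 (sup S) q) => //; apply: Pq; rewrite sq lexx.
by rewrite leNgt sq.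
Qed.

(** * Order and topology of the disconnection *)

Section Disconnection.
Context (R : realType) (D : set R).
Local Notation X := (disconnection D).

Fact in_disconnection0 : in_disconnection D (0, false).
Proof. by rewrite /in_disconnection /= in_itv/= lexx ler01. Qed.

Let point0 : disconnection_of D := Disconnection in_disconnection0.

(* plus x and minus x are x^+ and x^- for x in D \ {0, 1}, and both are x for
   the other x in [0, 1]; outside [0, 1] they have the junk value 0. *)
Definition plus (x : R) : X := insubd point0 (x, `[< (D `\` [set 0; 1]) x >]).
Definition minus (x : R) : X := insubd point0 (x, false).

Definition side (p : X) : bool := (\val (p : disconnection_of D)).2.

Lemma val_plus x : 0 <= x <= 1 ->
  \val (plus x : disconnection_of D) = (x, `[< (D `\` [set 0; 1]) x >]).
Proof.
by move=> x01; rewrite insubdK// unfold_in /in_disconnection /= in_itv/= x01 implybb.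
Qed.

Lemma val_minus x : 0 <= x <= 1 -> \val (minus x : disconnection_of D) = (x, false).
Proof. by move=> x01; rewrite insubdK// unfold_in /in_disconnection /= in_itv/= x01. Qed.

Lemma collapse_plus x : 0 <= x <= 1 -> collapse (plus x) = x.
Proof. by move=> x01; rewrite /collapse val_plus. Qed.

Lemma collapse_minus x : 0 <= x <= 1 -> collapse (minus x) = x.
Proof. by move=> x01; rewrite /collapse val_minus. Qed.

Lemma side_plus x : 0 <= x <= 1 -> side (plus x) = `[< (D `\` [set 0; 1]) x >].
Proof. by move=> x01; rewrite /side val_plus. Qed.

Lemma side_minus x : 0 <= x <= 1 -> side (minus x) = false.
Proof. by move=> x01; rewrite /side val_minus. Qed.

Lemma disconnectionP (p : X) :
  0 <= collapse p <= 1 /\ (side p -> (D `\` [set 0; 1]) (collapse p)).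
Proof.
rewrite /collapse /side; case: p => -[x b] /= /andP[/=].
by rewrite in_itv/= => x01 /implyP bD; split=> // /bD/asboolP.
Qed.

Lemma disconnection_eqP (p q : X) : collapse p = collapse q -> side p = side q -> p = q.
Proof.
rewrite /collapse /side => e1 e2; apply: (@val_inj _ _ (disconnection_of D)).
by case: (\val (p : disconnection_of D)) (\val (q : disconnection_of D)) e1 e2
  => [x b] [y c] /= -> ->.
Qed.

Lemma disconnection_leE (p q : X) :
  (p <= q) = (collapse p < collapse q) ||
             ((collapse p == collapse q) && (side p ==> side q)).
Proof.
have -> : (p <= q) = (\val (p : disconnection_of D) <= \val (q : disconnection_of D))%O by [].
rewrite /collapse /side.
case: (\val (p : disconnection_of D)) (\val (q : disconnection_of D)) => [x b] [y c] /=.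
rewrite Order.ProdLexiOrder.lexi_pair.
by case: (ltgtP x y) => // _; case: b c => [] [].
Qed.

Lemma disconnection_ltE (p q : X) :
  (p < q) = (collapse p < collapse q) ||
            ((collapse p == collapse q) && (~~ side p && side q)).
Proof.
rewrite ltNge disconnection_leE; case: ltgtP => //= _.
by case: (side p) (side q) => [] [].
Qed.

(** The two cases overlap at the points of ]0, 1[ outside [D], where both copies coincide. The point
    0 counts as a right copy and 1 as a left copy. *)
Lemma plus_minusP (p : X) : (exists2 x, 0 <= x < 1 & p = plus x) \/
  (exists2 x, 0 < x <= 1 & p = minus x).
Proof.
have [/[dup] x01 /andP[x0 x1] sD] := disconnectionP p.
have [sp|] := boolP (side p).
  have [Dx nx01] := sD sp.
  left; exists (collapse p).
    by rewrite x0 lt_neqAle x1 andbT; apply/eqP => x1'; apply: nx01; right.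
  apply: disconnection_eqP; first by rewrite collapse_plus.
  by rewrite side_plus// sp; apply/esym/asboolP; exact: sD.
move=> /negbTE sp; move: x0; rewrite le_eqVlt => /predU1P[x0|x0].
  left; exists 0; first by rewrite lexx ltr01.
  apply: disconnection_eqP; first by rewrite collapse_plus ?lexx ?ler01.
  rewrite sp side_plus ?lexx ?ler01//; apply/esym/asboolP => -[_]; apply; by left.
right; exists (collapse p); first by rewrite x0.
by apply: disconnection_eqP; rewrite ?collapse_minus// side_minus.
Qed.

Lemma plus_eq_minus x : 0 <= x <= 1 -> ~ (D `\` [set 0; 1]) x -> plus x = minus x.
Proof.
move=> x01 nDx; apply: disconnection_eqP.
  by rewrite collapse_plus// collapse_minus.
by rewrite side_plus// side_minus//; apply/asboolPn.
Qed.

Lemma plus_neq_minus x : 0 < x < 1 -> D x -> plus x <> minus x.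
Proof.
move=> /andP[x0 x1] Dx /(congr1 side).
have x01 : 0 <= x <= 1 by rewrite !ltW.
rewrite side_plus// side_minus// => /asboolPn; apply; split=> //.
by move=> [] /= xE; [rewrite xE ltxx in x0|rewrite xE ltxx in x1].
Qed.

(* U contains [x^+, y^-]. The points of the disconnection are only ever handled
   through plus on [0, 1[ and minus on ]0, 1], so that no case distinction on
   membership in D is needed. *)
Definition fills (U : set X) x y :=
  (forall z, x <= z < y -> U (plus z)) /\ (forall z, x < z <= y -> U (minus z)).

(** Only the ends need care: a right copy over [y] lying below y^- means that [y] is not doubled, so
    it equals the left copy; likewise at [x]. *)
Lemma fillsP (U : set X) x y p : 0 <= x -> x < y -> y <= 1 -> fills U x y ->
  plus x <= p -> p <= minus y -> U p.
Proof.
move=> x0 xy y1 [fp fm].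
have x01 : 0 <= x <= 1 by rewrite x0 ltW// (lt_le_trans xy).
have y01 : 0 <= y <= 1 by rewrite y1 (le_trans x0)// ltW.
rewrite !disconnection_leE collapse_plus// collapse_minus// side_minus// side_plus//.
have [[z /andP[z0 z1] ->]|[z /andP[z0 z1] ->]] := plus_minusP p.
  have z01 : 0 <= z <= 1 by rewrite z0 ltW.
  rewrite collapse_plus// side_plus//.
  move=> xz; have {}xz : x <= z by case/orP: xz => [/ltW//|/andP[/eqP ->]].
  case/orP => [zy|/andP[/eqP zy]]; first by apply: fp; rewrite xz.
  rewrite implybF => /asboolPn nDz; rewrite plus_eq_minus//.
  by apply: fm; rewrite zy xy lexx.
have z01 : 0 <= z <= 1 by rewrite z1 ltW.
rewrite collapse_minus// side_minus//.
move=> xz zy; have {}zy : z <= y by case/orP: zy => [/ltW//|/andP[/eqP ->]].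
move: xz; case/orP => [xz|/andP[/eqP xz]]; first by apply: fm; rewrite xz.
rewrite implybF -xz => /asboolPn nDz; rewrite -plus_eq_minus//.
by apply: fp; rewrite lexx.
Qed.

(** Three cases: [p] is some x^+ and the order interval up to y^- serves; [p] is a left copy
    distinct from x^+, with nothing between them; or [p] is the maximum 1. *)
Let nbhs_ge (p : X) (U : set X) : U p ->
  (forall x, 0 <= x < 1 -> p = plus x -> exists2 y, x < y <= 1 & fills U x y) ->
  nbhs p [set q | p <= q -> U q].
Proof.
move=> Up Ur.
have [[x x01 px]|nplus] := pselect (exists2 x, 0 <= x < 1 & p = plus x).
  have [y /andP[xy y1] xyU] := Ur x x01 px; have /andP[x0 x1] := x01.
  rewrite itv_nbhsE; exists `]-oo, (minus y)[; first split=> //.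
    rewrite in_itv/= px disconnection_ltE collapse_plus ?x0 ?ltW//.
    by rewrite collapse_minus ?xy// y1 (le_trans x0)// ltW.
  move=> q /=; rewrite in_itv/= px => qy xq.
  by apply: fillsP x0 xy y1 xyU xq _; exact: ltW.
have [//|[x /andP[x0 x1] px]] := plus_minusP p.
have x01 : 0 <= x <= 1 by rewrite x1 ltW.
have [xlt1|xge1] := ltP x 1.
  rewrite itv_nbhsE; exists `]-oo, (plus x)[; first split=> //.
    have ple : minus x <= plus x.
      by rewrite disconnection_leE collapse_plus// collapse_minus// side_minus// eqxx orbT.
    rewrite in_itv/= px lt_neqAle ple andbT; apply/eqP => e; apply: nplus.
    by exists x; rewrite ?px// ltW.
  move=> q /=; rewrite in_itv/= => qx pq.
  suff -> : q = p by [].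
  move: qx pq; rewrite px disconnection_ltE disconnection_leE.
  rewrite collapse_plus// collapse_minus// side_minus// side_plus//.
  case: ltgtP => //= cq /andP[sq _] _; apply: disconnection_eqP.
    by rewrite collapse_minus.
  by rewrite side_minus//; apply: negbTE.
have {x1 xge1} xE : x = 1 by apply/eqP; rewrite eq_le x1.
apply: (@filterS _ (nbhs p) _ setT) => [q _ /= pq|]; last exact: filterT.
suff -> : q = p by [].
have [/andP[_ q1] qD] := disconnectionP q.
move: pq; rewrite px xE disconnection_leE collapse_minus ?lexx ?ler01//.
rewrite side_minus ?lexx ?ler01//.
rewrite ltNge q1/= andbT => /eqP q1'.
apply: disconnection_eqP; first by rewrite collapse_minus ?lexx ?ler01.
rewrite side_minus ?lexx ?ler01//; apply/negP => /qD[_]; apply; by right.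
Qed.

Let nbhs_le (p : X) (U : set X) : U p ->
  (forall x, 0 < x <= 1 -> p = minus x -> exists2 y, 0 <= y < x & fills U y x) ->
  nbhs p [set q | q <= p -> U q].
Proof.
move=> Up Ul.
have [[x x01 px]|nminus] := pselect (exists2 x, 0 < x <= 1 & p = minus x).
  have [y /andP[y0 yx] yxU] := Ul x x01 px; have /andP[x0 x1] := x01.
  rewrite itv_nbhsE; exists `](plus y), +oo[; first split=> //.
    rewrite in_itv/= andbT px disconnection_ltE collapse_minus ?x1 ?ltW//.
    by rewrite collapse_plus ?yx// y0 (le_trans _ x1)// ltW.
  move=> q /=; rewrite in_itv/= andbT px => yq qx.
  by apply: fillsP y0 yx x1 yxU _ qx; exact: ltW.
have [[x /andP[x0 x1] px]|//] := plus_minusP p.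
have x01 : 0 <= x <= 1 by rewrite x0 ltW.
have [xgt0|xle0] := ltP 0 x.
  rewrite itv_nbhsE; exists `](minus x), +oo[; first split=> //.
    have ple : minus x <= plus x.
      by rewrite disconnection_leE collapse_plus// collapse_minus// side_minus// eqxx orbT.
    rewrite in_itv/= andbT px lt_neqAle ple andbT; apply/eqP => e; apply: nminus.
    by exists x; rewrite ?px ?xgt0 ?ltW.
  move=> q /=; rewrite in_itv/= andbT => xq qp.
  suff -> : q = p by [].
  move: xq qp; rewrite px disconnection_ltE disconnection_leE.
  rewrite collapse_plus// collapse_minus// side_minus// side_plus//.
  case: ltgtP => //= cq sq; rewrite sq /= => Dx; apply: disconnection_eqP.
    by rewrite collapse_plus.
  by rewrite side_plus// sq Dx.
have {x0 xle0} xE : x = 0 by apply/eqP; rewrite eq_le x0 xle0.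
apply: (@filterS _ (nbhs p) _ setT) => [q _ /= pq|]; last exact: filterT.
suff -> : q = p by [].
have [/andP[q0 _] qD] := disconnectionP q.
have p0s : side (plus 0) = false.
  rewrite side_plus ?lexx ?ler01//; apply/asboolPn => -[_]; apply; by left.
move: pq; rewrite px xE disconnection_leE collapse_plus ?lexx ?ler01// p0s implybF.
rewrite ltNge q0/= => /andP[/eqP q0' /negbTE sq].
by apply: disconnection_eqP; rewrite ?p0s// collapse_plus ?lexx ?ler01.
Qed.

(** Right copies only see points to their right, left copies only points to their left; an undoubled
    point has both descriptions and both conditions apply. *)
Lemma nbhs_disconnectionP (p : X) (U : set X) : nbhs p U <->
  (forall x, 0 <= x < 1 -> p = plus x -> exists2 y, x < y <= 1 & fills U x y) /\
  (forall x, 0 < x <= 1 -> p = minus x -> exists2 y, 0 <= y < x & fills U y x).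
Proof.
split=> [|[Ur Ul]]; last first.
  have Up : U p.
    have [[x x01 px]|[x x01 px]] := plus_minusP p.
      have [y /andP[xy _] [fp _]] := Ur x x01 px.
      by rewrite px; apply: fp; rewrite lexx.
    have [y /andP[_ xy] [_ fm]] := Ul x x01 px.
    by rewrite px; apply: fm; rewrite lexx andbT.
  apply: filterS (filterI (nbhs_ge Up Ur) (nbhs_le Up Ul)) => q /= [qU Uq].
  by have [/qU|/ltW/Uq] := leP p q.
rewrite itv_nbhsE => -[[l r] [lr +] iU]; rewrite itv_boundlr => /andP[lp pr].
have lpE q : p <= q -> (l <= BLeft q)%O by move=> pq; apply: le_trans lp _; rewrite bnd_simp.
have prE q : q <= p -> (BRight q <= r)%O by move=> qp; apply: le_trans pr; rewrite bnd_simp.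
have mem q : (l <= BLeft q)%O -> (BRight q <= r)%O -> U q.
  by move=> lq qr; apply: iU; rewrite /= itv_boundlr lq.
split=> x /[dup] x01 /andP[x0 x1] px.
- have [y [xy y1 yr]] : exists y, [/\ x < y, y <= 1 & (BRight (minus y) <= r)%O].
    case: r lr {iU mem prE} pr => [b v|[]//] lr pr; last by exists 1.
    rewrite (itv_open_ends_rside lr) in pr *; rewrite bnd_simp px in pr.
    have [/andP[v0 v1] vD] := disconnectionP v.
    have xv : x < collapse v.
      move: pr; rewrite disconnection_ltE collapse_plus ?x0 ?ltW// side_plus ?x0 ?ltW//.
      by case: ltgtP => //= xv /andP[/asboolPn nDx /vD]; rewrite -xv.
    (* A point strictly between [x] and the position of the bound [v], so that its left copy is
       below [v] whichever copy [v] is. *)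
    exists ((x + collapse v) / 2); split; [lra|lra|].
    rewrite bnd_simp disconnection_ltE collapse_minus; last by apply/andP; split; lra.
    by apply/orP; left; lra.
  have y0 : 0 <= y by rewrite (le_trans x0)// ltW.
  have y01 : 0 <= y <= 1 by rewrite y0.
  have x01' : 0 <= x <= 1 by rewrite x0 ltW.
  exists y; first by rewrite xy.
  split=> z /andP[xz zy].
    have z01 : 0 <= z <= 1 by rewrite (le_trans x0)//= (le_trans _ y1)// ltW.
    apply: mem.
      apply: lpE; rewrite px disconnection_leE !collapse_plus//.
      by move: xz; rewrite le_eqVlt => /predU1P[->|->//]; rewrite eqxx implybb orbT.
    apply: le_trans yr; rewrite bnd_simp disconnection_leE collapse_plus//.
    by rewrite collapse_minus// zy.
  have z01 : 0 <= z <= 1 by rewrite (le_trans zy)// andbT (le_trans x0)// ltW.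
  apply: mem.
    apply: lpE; rewrite px disconnection_leE collapse_plus//.
    by rewrite collapse_minus// xz.
  apply: le_trans yr; rewrite bnd_simp disconnection_leE !collapse_minus//.
  rewrite !side_minus//.
  by move: zy; rewrite le_eqVlt => /predU1P[->|->//]; rewrite eqxx orbT.
- have [y [yx y0 yl]] : exists y, [/\ y < x, 0 <= y & (l <= BLeft (plus y))%O].
    case: l lr {iU mem lpE} lp => [b v|[]//] lr lp; last by exists 0.
    rewrite (itv_open_ends_lside lr) in lp *; rewrite bnd_simp px in lp.
    have [/andP[v0 v1] vD] := disconnectionP v.
    have vx : collapse v < x.
      move: lp; rewrite disconnection_ltE collapse_minus ?x1 ?ltW// side_minus ?x1 ?ltW//.
      by case: ltgtP => //= _; rewrite andbF.
    exists ((x + collapse v) / 2); split; [lra|lra|].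
    rewrite bnd_simp disconnection_ltE collapse_plus; last by apply/andP; split; lra.
    by apply/orP; left; lra.
  have y1 : y <= 1 by rewrite (le_trans _ x1)// ltW.
  have y01 : 0 <= y <= 1 by rewrite y0.
  have x01' : 0 <= x <= 1 by rewrite x1 ltW.
  exists y; first by rewrite y0.
  split=> z /andP[yz zx].
    have z01 : 0 <= z <= 1 by rewrite (le_trans y0)//= (le_trans _ x1)// ltW.
    apply: mem.
      apply: le_trans yl _; rewrite bnd_simp disconnection_leE !collapse_plus//.
      by move: yz; rewrite le_eqVlt => /predU1P[->|->//]; rewrite eqxx implybb orbT.
    apply: prE; rewrite px disconnection_leE collapse_plus//.
    by rewrite collapse_minus// zx.
  have z01 : 0 <= z <= 1 by rewrite (le_trans zx)// andbT (le_trans y0)// ltW.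
  apply: mem.
    apply: le_trans yl _; rewrite bnd_simp disconnection_leE collapse_plus//.
    by rewrite collapse_minus// yz.
  apply: prE; rewrite px disconnection_leE !collapse_minus//.
  rewrite !side_minus//.
  by move: zx; rewrite le_eqVlt => /predU1P[->|->//]; rewrite eqxx orbT.
Qed.

End Disconnection.

(** * Steps and jumps of continuous integer functions *)

Section DisconnectionFunctions.
Context (R : realType) (D : set R).
Local Notation X := (disconnection D).
Local Notation plus := (@plus R D).
Local Notation minus := (@minus R D).

Section Glue.
Context (Y : Type) (F G : R -> Y).

(** The point 0 has side [false] but is treated as a right copy, whence the extra test. *)
Definition glue_sides (p : X) : Y :=
  if side p || (collapse p == 0) then F (collapse p) else G (collapse p).

Lemma glue_sides_minus x : 0 < x <= 1 -> glue_sides (minus x) = G x.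
Proof.
move=> /andP[x0 x1]; have x01 : 0 <= x <= 1 by rewrite x1 ltW.
by rewrite /glue_sides side_minus// collapse_minus// gt_eqF.
Qed.

Lemma glue_sides_plus x : (forall z, 0 < z < 1 -> ~ D z -> F z = G z) ->
  0 <= x < 1 -> glue_sides (plus x) = F x.
Proof.
move=> FG /andP[x0 x1]; have x01 : 0 <= x <= 1 by rewrite x0 ltW.
rewrite /glue_sides side_plus// collapse_plus//.
case: asboolP => // nDx; have [//|xn0] := eqVneq x 0; rewrite FG// ?x1 ?lt0r ?xn0 ?x0//.
move=> Dx; apply: nDx; split=> // -[|] /= xE; first by rewrite xE eqxx in xn0.
by rewrite xE ltxx in x1.
Qed.

End Glue.

Lemma continuous_int_disconnectionP (f : X -> int) : continuous_int f <->
  (forall x, 0 <= x < 1 ->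
     exists2 y, x < y <= 1 & fills [set p | f p = f (plus x)] x y) /\
  (forall x, 0 < x <= 1 ->
     exists2 y, 0 <= y < x & fills [set p | f p = f (minus x)] y x).
Proof.
rewrite continuous_intP; split=> [cf|[fp fm] p].
  split=> x x01.
    by have /nbhs_disconnectionP[+ _] := cf (plus x); apply.
  by have /nbhs_disconnectionP[_ +] := cf (minus x); apply.
by apply/nbhs_disconnectionP; split=> x x01 ->; [exact: fp|exact: fm].
Qed.

(* The indicator function of [u^+, 1], for u in D; for other u it need not be
   continuous and step u may be the junk value 0. *)
Definition step (u : R) : cont_int X := xget 0 [set f : cont_int X |
  (forall x, 0 <= x < 1 -> f (plus x) = (u <= x)%R%:Z) /\
  (forall x, 0 < x <= 1 -> f (minus x) = (u < x)%R%:Z)].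

(** Both formulas agree at every point other than [u]. As [u] lies in [D], they agree wherever the
    two copies coincide, so they glue to a locally constant function. *)
Lemma stepP u : D u ->
  (forall x, 0 <= x < 1 -> step u (plus x) = (u <= x)%R%:Z) /\
  (forall x, 0 < x <= 1 -> step u (minus x) = (u < x)%R%:Z).
Proof.
move=> Du; pose F x := (u <= x)%R%:Z; pose G x := (u < x)%R%:Z.
have FG z : 0 < z < 1 -> ~ D z -> F z = G z.
  by move=> _ nDz; rewrite /F /G le_eqVlt; case: eqP => // uz; case: nDz; rewrite -uz.
pose f := glue_sides F G.
have fp x : 0 <= x < 1 -> f (plus x) = F x by exact: glue_sides_plus.
have fm x : 0 < x <= 1 -> f (minus x) = G x by exact: glue_sides_minus.
have cf : continuous_int f.
  apply/continuous_int_disconnectionP; split=> x /[dup] x01 /andP[x0 x1].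
    have [ux|xu] := leP u x.
      exists 1; rewrite ?x1 ?lexx//; split=> z /andP[xz z1].
        have z01 : 0 <= z < 1 by rewrite (le_trans x0).
        by rewrite /= !fp// /F ux (le_trans ux).
      have z01 : 0 < z <= 1 by rewrite (le_lt_trans x0).
      by rewrite /= fp// fm// /F /G ux (le_lt_trans ux).
    (* [D] is an arbitrary set of reals here, so [u] has to be truncated to [0, 1]. *)
    exists (Num.min u 1); first by rewrite lt_min xu x1 ge_min lexx orbT.
    split=> z /andP[xz].
      rewrite lt_min => /andP[zu z1]; have z01 : 0 <= z < 1 by rewrite (le_trans x0).
      by rewrite /= !fp// /F (lt_geF xu) (lt_geF zu).
    rewrite le_min => /andP[zu z1]; have z01 : 0 < z <= 1 by rewrite (le_lt_trans x0).
    by rewrite /= fp// fm// /F /G (lt_geF xu) (le_gtF zu).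
  have [ux|xu] := ltP u x.
    exists (Num.max u 0); first by rewrite gt_max ux x0 le_max lexx orbT.
    split=> z /andP[+ zx].
      rewrite ge_max => /andP[uz z0]; have z01 : 0 <= z < 1 by rewrite z0 (lt_le_trans zx).
      by rewrite /= fp// fm// /F /G ux uz.
    rewrite gt_max => /andP[uz z0]; have z01 : 0 < z <= 1 by rewrite z0 (le_trans zx).
    by rewrite /= !fm// /G ux uz.
  exists 0; first by rewrite x0 lexx.
  split=> z /andP[z0 zx].
    have z01 : 0 <= z < 1 by rewrite z0 (lt_le_trans zx).
    by rewrite /= fp// fm// /F /G (le_gtF xu) (lt_geF (lt_le_trans zx xu)).
  have z01 : 0 < z <= 1 by rewrite z0 (le_trans zx).
  by rewrite /= !fm// /G (le_gtF xu) (le_gtF (le_trans zx xu)).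
rewrite /step; case: xgetP => [g -> []//|/(_ (mk_cont_int cf))[]].
by split.
Qed.

Lemma step0E : D 0 -> forall p, step 0 p = 1.
Proof.
move=> /stepP[ep em] p; have [[x x01 ->]|[x x01 ->]] := plus_minusP p.
  by rewrite ep//; case/andP: x01 => ->.
by rewrite em//; case/andP: x01 => ->.
Qed.

Definition eval_at (p : X) (f : cont_int X) : int := f p.

Lemma eval_at_zmod p : zmod_morphism (eval_at p).
Proof. by []. Qed.
HB.instance Definition _ p := GRing.isZmodMorphism.Build _ _ (eval_at p) (eval_at_zmod p).

Definition jump (z : R) (f : cont_int X) : int := f (plus z) - f (minus z).

Lemma jump_zmod z : zmod_morphism (jump z).
Proof.
move=> f g; have jE h : jump z h = eval_at (plus z) h - eval_at (minus z) h by [].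
rewrite !jE !(raddfB (eval_at _)) /= !opprB addrACA [RHS]addrACA; congr (_ + _).
by rewrite addrC.
Qed.
HB.instance Definition _ z := GRing.isZmodMorphism.Build _ _ (jump z) (jump_zmod z).

Lemma jump_step u z : D u -> 0 < z < 1 -> jump z (step u) = (z == u)%:Z.
Proof.
move=> /stepP[ep em] /andP[z0 z1].
have zp : 0 <= z < 1 by rewrite z1 ltW.
have zm : 0 < z <= 1 by rewrite z0 ltW.
rewrite /jump (ep z zp) (em z zm).
by rewrite le_eqVlt [u == z]eq_sym; case: eqVneq => [->|_] /=; rewrite ?ltxx// subrr.
Qed.

Lemma jump_orbit f z : 0 < z < 1 -> jump z f != 0 -> D z.
Proof.
move=> /andP[z0 z1]; apply: contraPP => nDz; apply/negP; rewrite negbK.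
by rewrite /jump plus_eq_minus ?subrr// ?ltW// => -[].
Qed.

(** Compactness via [cousin]: local constancy gives short one-sided intervals without inner jumps,
    and gluing two intervals adds only their common end. *)
Lemma finite_jumps (f : cont_int X) :
  exists s : seq R, forall z, 0 < z < 1 -> z \notin s -> jump z f = 0.
Proof.
have /continuous_int_disconnectionP[fp fm] := @cont_intP _ f.
apply: (@cousin R (fun x y => exists s : seq R,
  forall z, x < z < y -> z \notin s -> jump z f = 0)).
- move=> x y z x0 xy yz z1 [s sP] [t tP]; exists (y :: s ++ t) => w /andP[xw wz].
  rewrite inE mem_cat !negb_or => /and3P[wy ws wt].
  have [wly|ywt] := ltP w y; first by apply: sP; rewrite ?xw.
  by apply: tP; rewrite ?wz// andbT lt_neqAle eq_sym wy.
- move=> x x01; have [y xy [Up Um]] := fp x x01; exists y => // z /andP[xz zy].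
  exists [::] => w /andP[xw wz] _; apply/eqP; rewrite subr_eq0; apply/eqP.
  by rewrite Up ?Um// ?xw ?(ltW xw) ?(lt_le_trans wz)// ltW// (lt_le_trans wz).
- move=> x x01; have [y yx [Up Um]] := fm x x01; exists y => // z /andP[yz zx].
  exists [::] => w /andP[zw wx] _; apply/eqP; rewrite subr_eq0; apply/eqP.
  by rewrite Up ?Um// ?wx ?(ltW wx) ?(le_lt_trans yz)// ltW// (le_lt_trans yz).
Qed.

(** The same covering argument; the absence of a jump at the common end lets the constant values of
    two adjacent intervals match. *)
Lemma jumpless_constant (f : cont_int X) :
  (forall z, 0 < z < 1 -> jump z f = 0) -> forall p, f p = f (plus 0).
Proof.
have /continuous_int_disconnectionP[fp fm] := @cont_intP _ f.
move=> f0 p.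
have : fills [set q | f q = f (plus 0)] 0 1.
  apply: (@cousin R (fun x y => fills [set q | f q = f (plus x)] x y)).
  - move=> x y z x0 xy yz z1 [p1 m1] [p2 m2].
    have fy : f (plus y) = f (plus x).
      rewrite -[RHS](m1 y) ?xy ?lexx//; apply/eqP; rewrite -subr_eq0; apply/eqP.
      by apply: f0; rewrite (le_lt_trans x0) ?(lt_le_trans yz).
    split=> w /andP[xw wz] /=.
      have [wy|yw] := ltP w y; first by apply: p1; rewrite xw.
      by rewrite p2 ?yw.
    have [wy|yw] := leP w y; first by apply: m1; rewrite xw.
    by rewrite m2 ?yw.
  - move=> x x01; have [y xy [Up Um]] := fp x x01; exists y => // z /andP[xz zy].
    split=> w /andP[xw wz]; first by apply: Up; rewrite xw (lt_le_trans wz).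
    by apply: Um; rewrite xw (le_trans wz).
  - move=> x x01; have [y yx [Up Um]] := fm x x01; exists y => // z /andP[yz zx].
    have fz : f (plus z) = f (minus x) by apply: Up; rewrite yz.
    split=> w /andP[xw wz] /=; rewrite fz.
      by apply: Up; rewrite wz (le_trans yz).
    by apply: Um; rewrite wz (le_lt_trans yz).
move=> [Up Um]; have [[x x01 ->]|[x x01 ->]] := plus_minusP p; [exact: Up|exact: Um].
Qed.

(** Induction on a finite list containing all jumps: subtracting the right multiple of [step u]
    removes the jump at [u] and changes no other. What remains is a constant, a multiple of
    [step 0]. *)
Lemma jump_span (S : cont_int X -> Prop) : D 0 -> S 0 ->
  (forall f g, S f -> S g -> S (f - g)) -> S (step 0) ->
  forall f, (forall z, 0 < z < 1 -> jump z f != 0 -> S (step z)) -> S f.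
Proof.
move=> D0 S0 SB Sc f Sf.
have SD g h : S g -> S h -> S (g + h).
  by move=> Sg Sh; rewrite -[h]opprK; apply: (SB) => //; rewrite -sub0r; exact: SB.
have SMz g c : S g -> S (g *~ c).
  move=> Sg; have SMn k : S (g *+ k).
    by elim: k => [|k IH]; rewrite ?mulr0n// mulrS; exact: SD.
  by case: c => k; [exact: SMn|rewrite NegzE mulrNz -sub0r; apply: SB => //; exact: SMn].
have [s sP] := finite_jumps f.
elim: s => [|u s IH] in f Sf sP *.
  suff -> : f = step 0 *~ f (plus 0) by exact: SMz.
  apply: cont_int_ext => p; rewrite -/(eval_at p _) -/(eval_at p _) raddfMz /=.
  rewrite /eval_at step0E// intz; apply: jumpless_constant => z z01; exact: sP.
have [fu|fu] := pselect (0 < u < 1 /\ jump u f != 0); last first.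
  apply: IH => // z z01 zs; have [zu|zu] := eqVneq z u; last first.
    by apply: sP => //; rewrite inE negb_or zu.
  by apply/eqP/negPn/negP => fz; apply: fu; rewrite -zu.
have [u01 ju] := fu; have Du := jump_orbit u01 ju.
pose g := f - step u *~ jump u f.
have jg z : 0 < z < 1 -> jump z g = jump z f - (z == u)%:Z *~ jump u f.
  by move=> z01; rewrite raddfB /= raddfMz /= jump_step.
rewrite -[f](subrK (step u *~ jump u f)); apply: SD; last exact/SMz/Sf.
apply: IH => z z01.
  rewrite jg//; have [->|zu] := eqVneq z u; first by rewrite intz subrr eqxx.
  by rewrite mul0rz subr0; exact: Sf.
move=> zs; rewrite jg//; have [->|zu] := eqVneq z u; first by rewrite intz subrr.
by rewrite mul0rz subr0 sP// inE negb_or zu.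
Qed.

End DisconnectionFunctions.

(** * The transfer map *)

Lemma itvcoW (R : realType) (x : R) : 0 <= x < 1 -> 0 <= x <= 1.
Proof. by case/andP => -> /ltW ->. Qed.

Lemma itvocW (R : realType) (x : R) : 0 < x <= 1 -> 0 <= x <= 1.
Proof. by case/andP => /ltW -> ->. Qed.

Section Transfer.

Context (R : realType) (tau : R -> R) (n : nat) (a : nat -> R).
Hypothesis tau_iem : interval_exchange tau n a.
Local Notation C := (a @` [set i | (i <= n)%N]).
Local Notation D := (generalized_orbit tau C).
Local Notation X := (disc_space tau C).
Local Notation CX := (cont_int X).
Local Notation plus := (@plus R D).
Local Notation minus := (@minus R D).
Local Notation tl := (left_limit tau).

Lemma orbit0 : D 0.
Proof. by rewrite -(partition_first tau_iem); exact: orbit_partition. Qed.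

Lemma orbit1 : D 1.
Proof. by rewrite -(partition_last tau_iem); exact: orbit_partition. Qed.

Lemma not_orbit_itv x : 0 <= x <= 1 -> ~ D x -> 0 < x < 1.
Proof.
move=> /andP[x0 x1] nDx; rewrite !lt_neqAle x0 x1 !andbT.
apply/andP; split; apply/eqP => xE; apply: nDx.
  by rewrite -xE; exact: orbit0.
by rewrite xE; exact: orbit1.
Qed.

Definition sigma : X -> X :=
  @glue_sides R D X (fun x => plus (tau x)) (fun x => minus (tl x)).

Lemma sigma_minus x : 0 < x <= 1 -> sigma (minus x) = minus (tl x).
Proof. by move=> x01; rewrite /sigma glue_sides_minus. Qed.

(** The two formulas gluing to [sigma] are compatible: at an undoubled point [tau] equals its left
    limit, and the image is undoubled too. *)
Lemma sigma_plus x : 0 <= x < 1 -> sigma (plus x) = plus (tau x).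
Proof.
move=> x01; rewrite /sigma glue_sides_plus// => z z01 nDz.
have nCz : ~ C z by move=> -[i /= ni iz]; apply: nDz; rewrite -iz; exact: orbit_partition.
have z01' : 0 <= z < 1 by case/andP: z01 => /ltW -> ->.
rewrite (left_limit_continuity tau_iem z01 nCz) plus_eq_minus//.
  by have /andP[-> /ltW ->] := tau_itv tau_iem z01'.
by move=> [/(orbit_tau tau_iem z01')].
Qed.

Lemma in_piece_right_itv x y z : in_piece n a x y -> x <= z < y -> tau x <= tau z < tl y.
Proof.
move=> xy /andP[xz zy]; rewrite (tau_lt_left_limit tau_iem xy)// andbT.
move: xz; rewrite le_eqVlt => /predU1P[->//|xz].
by rewrite ltW// (tau_lt tau_iem xy).
Qed.

Lemma in_piece_left_itv x y z : in_piece n a x y -> x < z <= y -> tau x < tl z <= tl y.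
Proof.
move=> xy /andP[xz zy]; rewrite (tau_lt_left_limit tau_iem xy)//=.
move: zy; rewrite le_eqVlt => /predU1P[->//|zy].
by rewrite ltW// (left_limit_lt tau_iem xy).
Qed.

(** Within a piece, [x^+, y^-] is sent into [(tau x)^+, (tl y)^-], and [y] can be chosen to make the
    image as short as required. *)
Lemma sigma_continuous : continuous sigma.
Proof.
move=> p U /nbhs_disconnectionP[Up Um]; apply/nbhs_disconnectionP; split=> x x01 px.
  have tx01 := tau_itv tau_iem x01.
  have [|y' /andP[xy' y'1] [fp fm]] := Up (tau x) tx01; first by rewrite px sigma_plus.
  have /andP[x0 x1] := x01.
  have [y xy [_ yy']] := tau_near tau_iem x01 xy' x1.
  have [_ ltxy y1] := in_piece_bound tau_iem xy.
  exists y; first by rewrite ltxy.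
  split=> z xzy; have /andP[xz zy] := xzy.
    rewrite /= sigma_plus; last by rewrite (le_trans x0)//= (lt_le_trans zy).
    have /andP[tz1 tz2] := in_piece_right_itv xy xzy.
    by apply: fp; rewrite tz1 (lt_trans tz2).
  rewrite /= sigma_minus; last by rewrite (le_lt_trans x0)//= (le_trans zy).
  have /andP[tz1 tz2] := in_piece_left_itv xy xzy.
  by apply: fm; rewrite tz1 (le_trans tz2)// ltW.
have tx01 := left_limit_itv tau_iem x01.
have [|y' /andP[y'0 y'x] [fp fm]] := Um (tl x) tx01; first by rewrite px sigma_minus.
have /andP[x0 x1] := x01.
have [y yx [_ y'y]] := left_limit_near tau_iem x01 y'x x0.
have [y0 ltyx _] := in_piece_bound tau_iem yx.
exists y; first by rewrite y0.
split=> z yzx; have /andP[yz zx] := yzx.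
  rewrite /= sigma_plus; last by rewrite (le_trans y0)//= (lt_le_trans zx).
  have /andP[tz1 tz2] := in_piece_right_itv yx yzx.
  by apply: fp; rewrite tz2 (le_trans (ltW y'y)).
rewrite /= sigma_minus; last by rewrite (le_lt_trans y0)//= (le_trans zx).
have /andP[tz1 tz2] := in_piece_left_itv yx yzx.
by apply: fm; rewrite tz2 (lt_trans y'y).
Qed.

Lemma sigma_associated : is_associated_map sigma.
Proof.
split=> [|p]; first exact: sigma_continuous.
have plusE x : 0 <= x < 1 -> collapse (sigma (plus x)) = tau (collapse (plus x)).
  move=> x01; have tx01 := tau_itv tau_iem x01.
  by rewrite sigma_plus// !collapse_plus// itvcoW.
have [[x x01 ->] _|[x /andP[x0 x1] ->]] := plus_minusP p; first exact: plusE.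
have x01 : 0 <= x <= 1 by rewrite x1 ltW.
rewrite collapse_minus// => nDx; have /andP[_ x1'] := not_orbit_itv x01 nDx.
rewrite -plus_eq_minus//; last by case.
by rewrite plusE ?collapse_plus// x1' ltW.
Qed.

(** Uniqueness comes from density: over points outside [D] the collapse determines the image, and
    two continuous maps into a Hausdorff space that agree there coincide. *)
Lemma associated_mapE : associated_map (C := C) (tau := tau) = sigma.
Proof.
apply: xget_unique; first exact: sigma_associated.
move=> s [s_cont sE]; apply/funext => p.
apply: (@order_hausdorff _ X) => A B sA sB.
have /nbhs_disconnectionP[Up Um] : nbhs p (s @^-1` A `&` sigma @^-1` B).
  by apply: filterI; [exact: s_cont|exact: sigma_continuous].
have [x [y [x0 xy y1 [fp _]]]] : exists x y, [/\ 0 <= x, x < y, y <= 1 &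
    fills (s @^-1` A `&` sigma @^-1` B) x y].
  have [[x x01 px]|[x x01 px]] := plus_minusP p.
    have [y /andP[xy y1] f] := Up x x01 px; have /andP[x0 _] := x01.
    by exists x, y.
  have [y /andP[y0 yx] f] := Um x x01 px; have /andP[_ x1] := x01.
  by exists y, x.
have [z /andP[xz zy] nDz] := orbit_codense tau_iem x0 xy y1.
have z01 : 0 <= z < 1 by rewrite (le_trans x0 (ltW xz)) (lt_le_trans zy).
have z01' : 0 <= z <= 1 by case/andP: z01 => -> /ltW ->.
have [|sAz sBz] := fp z; first by rewrite zy ltW.
exists (s (plus z)); split=> //.
suff -> : s (plus z) = sigma (plus z) by [].
have nDtz : ~ D (tau z) by rewrite (orbit_tau tau_iem z01).
have nDcz : ~ D (collapse (plus z)) by rewrite collapse_plus.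
have csz : collapse (s (plus z)) = tau z by rewrite sE// collapse_plus.
have cgz : collapse (sigma (plus z)) = tau z.
  by rewrite (sigma_associated.2 (plus z))// collapse_plus.
have side0 (q : disconnection D) : collapse q = tau z -> side q = false.
  by move=> qz; apply/negP => /(disconnectionP q).2[+ _]; rewrite qz.
by apply: disconnection_eqP; rewrite ?csz ?cgz// !side0.
Qed.

Lemma sigma_surj q : exists p, sigma p = q.
Proof.
have [[y y01 ->]|[y y01 ->]] := plus_minusP q.
  by have [x x01 <-] := tau_surj tau_iem y01; exists (plus x); rewrite sigma_plus.
by have [x x01 <-] := left_limit_surj tau_iem y01; exists (minus x); rewrite sigma_minus.
Qed.

(** A right and a left copy can share an image only if that image is undoubled; then [y] is outside
    [D], its left limit is [tau y], and injectivity of [tau] gives x = y. *)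
Lemma sigma_inj : injective sigma.
Proof.
have mixed x y : 0 <= x < 1 -> 0 < y <= 1 -> sigma (plus x) = sigma (minus y) ->
    plus x = minus y.
  move=> x01 y01; rewrite sigma_plus// sigma_minus// => e.
  have /andP[tx0 tx1] := tau_itv tau_iem x01.
  have /andP[ty0 ty1] := left_limit_itv tau_iem y01.
  have txy : tau x = tl y.
    have := congr1 (@collapse R D) e.
    by rewrite collapse_plus ?itvcoW ?tx0// collapse_minus ?itvocW ?ty0.
  have nDtx : ~ D (tau x).
    move=> Dtx; apply: (@plus_neq_minus _ D (tau x)) => //; first by rewrite tx1 txy ty0.
    by rewrite e txy.
  have nDy : ~ D y by rewrite -(orbit_left_limit tau_iem y01) -txy.
  have /andP[y0 y1] : 0 < y < 1.
    by apply: not_orbit_itv nDy; case/andP: y01 => /ltW -> ->.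
  have xy : x = y.
    apply: (tau_inj tau_iem) => //; first by rewrite y1 ltW.
    rewrite txy; apply: (left_limit_continuity tau_iem); first by rewrite y0.
    by move=> [i /= ni iy]; apply: nDy; rewrite -iy; exact: orbit_partition.
  rewrite xy plus_eq_minus//; last by case.
  by rewrite !ltW.
move=> p q.
have [[x x01 ->]|[x x01 ->]] := plus_minusP p;
  have [[y y01 ->]|[y y01 ->]] := plus_minusP q => e.
- rewrite !sigma_plus// in e; congr plus; apply: (tau_inj tau_iem) => //.
  have tx01 := tau_itv tau_iem x01; have ty01 := tau_itv tau_iem y01.
  by have := congr1 (@collapse R D) e; rewrite !collapse_plus// itvcoW.
- exact: mixed.
- exact/esym/mixed.
- rewrite !sigma_minus// in e; congr minus; apply: (left_limit_inj tau_iem) => //.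
  have tx01 := left_limit_itv tau_iem x01; have ty01 := left_limit_itv tau_iem y01.
  by have := congr1 (@collapse R D) e; rewrite !collapse_minus// itvocW.
Qed.

Lemma pullback_continuous (f : CX) : continuous_int (f \o sigma).
Proof.
move=> p; apply: (@continuous_comp X X (discrete_topology int) sigma f).
  exact: sigma_continuous.
exact: cont_intP.
Qed.

Definition pullback (f : CX) : CX := mk_cont_int (pullback_continuous (f := f)).

(** Openness of [sigma] by hand: within a piece, the intermediate value lemmas show that [x^+, v^-]
    covers all of [(tau x)^+, (tl v)^-]. *)
Lemma pushforward_continuous (g : X -> X) (f : CX) : cancel sigma g ->
  continuous_int (f \o g).
Proof.
move=> gK; have /continuous_int_disconnectionP[fp fm] := @cont_intP _ f.
have gp x : 0 <= x < 1 -> g (plus (tau x)) = plus x.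
  by move=> x01; rewrite -sigma_plus// gK.
have gm x : 0 < x <= 1 -> g (minus (tl x)) = minus x.
  by move=> x01; rewrite -sigma_minus// gK.
apply/continuous_int_disconnectionP; split=> y y01.
  have [x x01 txy] := tau_surj tau_iem y01.
  have [r /andP[xr r1] [rp rm]] := fp x x01.
  have [w xw] := in_piece_right tau_iem x01.
  have [x0 ltxw w1] := in_piece_bound tau_iem xw.
  (* The interval on which [f] is constant is cut down to stay inside one piece. *)
  have xv : in_piece n a x (Num.min r w).
    by apply: in_pieceW xw _ _ _; rewrite ?lt_min ?xr ?ge_min ?lexx ?orbT.
  have vr : Num.min r w <= r by rewrite ge_min lexx.
  move: {w xw ltxw w1} (Num.min r w) xv vr => v xv vr.
  have [_ ltxv v1] := in_piece_bound tau_iem xv.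
  exists (tl v).
    rewrite -txy (tau_lt_left_limit tau_iem xv)//=.
    have /andP[] // : 0 < tl v <= 1.
    by apply: (left_limit_itv tau_iem); rewrite (le_lt_trans x0).
  rewrite -txy; split=> u /= uv.
    have [z /andP[xz zv] <-] := tau_ivt tau_iem xv uv.
    rewrite !gp//; last by rewrite (le_trans x0)//= (lt_le_trans zv).
    by apply: rp; rewrite xz (lt_le_trans zv).
  have [z /andP[xz zv] <-] := left_limit_ivt tau_iem xv uv.
  rewrite gp// gm; last by rewrite (le_lt_trans x0)//= (le_trans zv).
  by apply: rm; rewrite xz (le_trans zv).
have [x x01 txy] := left_limit_surj tau_iem y01.
have [r /andP[r0 rx] [rp rm]] := fm x x01.
have [w wx] := in_piece_left tau_iem x01.
have [w0 ltwx x1] := in_piece_bound tau_iem wx.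
have vx : in_piece n a (Num.max r w) x.
  by apply: in_pieceW wx _ _ _; rewrite ?gt_max ?rx ?le_max ?lexx ?orbT.
have rv : r <= Num.max r w by rewrite le_max lexx.
move: {w wx w0 ltwx} (Num.max r w) vx rv => v vx rv.
have [v0 ltvx _] := in_piece_bound tau_iem vx.
exists (tau v).
  rewrite -txy (tau_lt_left_limit tau_iem vx)//= andbT.
  by have /andP[] : 0 <= tau v < 1 by apply: (tau_itv tau_iem); rewrite v0 (lt_le_trans ltvx).
rewrite -txy; split=> u /= uv.
  have [z /andP[vz zx] <-] := tau_ivt tau_iem vx uv.
  rewrite gm// gp; last by rewrite (le_trans v0)//= (lt_le_trans zx).
  by apply: rp; rewrite zx (le_trans rv).
have [z /andP[vz zx] <-] := left_limit_ivt tau_iem vx uv.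
rewrite !gm//; last by rewrite (le_lt_trans v0)//= (le_trans zx).
by apply: rm; rewrite zx (le_lt_trans rv).
Qed.

(** Fibres of [sigma] are single points, so the transfer sum has one term. The existence of a
    continuous solution shows that [transfer] is not its default value. *)
Lemma transferE (f : CX) p : transfer tau C f (sigma p) = f p.
Proof.
have [g gK Kg] : bijective sigma.
  have /choice[g Kg] := sigma_surj; exists g => // q.
  by apply: sigma_inj; rewrite Kg.
have fiber q : [set p | sigma p = q] = [set g q].
  by apply/seteqP; split=> [p' /= <-|p' /= ->]; rewrite ?gK ?Kg.
suff tP : is_transfer (transfer tau C).
  by rewrite tP associated_mapE fiber fsbig_set1 gK.
have exL : exists L, @is_transfer R tau C L.
  pose L f : CX := mk_cont_int (@pushforward_continuous g f gK).
  have Ladd : zmod_morphism L by move=> f1 f2; exact: cont_int_ext.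
  pose L' : {additive CX -> CX} := HB.pack L (GRing.isZmodMorphism.Build CX CX L Ladd).
  exists L' => {}f q.
  by rewrite associated_mapE fiber fsbig_set1.
rewrite /transfer; case: (pselect (exists L, @is_transfer R tau C L)) => [e|//].
exact: (svalP (cid e)).
Qed.

Lemma transferK : cancel (transfer tau C) pullback.
Proof. by move=> f; apply: cont_int_ext => p; exact: transferE. Qed.

Lemma pullbackK : cancel pullback (transfer tau C).
Proof.
move=> f; apply: cont_int_ext => q; have [p <-] := sigma_surj q.
exact: transferE.
Qed.

Lemma pullback_zmod : zmod_morphism pullback.
Proof. by move=> f g; exact: cont_int_ext. Qed.
HB.instance Definition _ := GRing.isZmodMorphism.Build CX CX pullback pullback_zmod.

Lemma transfer1 : transfer tau C (step D 0) = step D 0.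
Proof.
apply: cont_int_ext => q; have [p <-] := sigma_surj q.
by apply: etrans (transferE _ _) _; rewrite !step0E//; exact: orbit0.
Qed.

(** Away from the partition, [sigma] sends the two copies of [z] to the two copies of the same point
    [tau z]. *)
Lemma jump_pullback f z : 0 < z < 1 -> ~ C z -> jump z (pullback f) = jump (tau z) f.
Proof.
move=> z01 nCz; have [z0 z1] := andP z01.
have -> : jump z (pullback f) = f (sigma (plus z)) - f (sigma (minus z)) by [].
rewrite sigma_plus ?sigma_minus ?(left_limit_continuity tau_iem z01 nCz)//.
  by rewrite z0 ltW.
by rewrite z1 ltW.
Qed.

Lemma jump_iter_pullback f z m : 0 <= z < 1 ->
  (forall k, (k < m)%N -> ~ C (iter k tau z)) ->
  jump z (iter m pullback f) = jump (iter m tau z) f.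
Proof.
move=> z01; elim: m f => // m IH f nC; rewrite iterSr IH; last first.
  by move=> k km; apply: nC; exact: ltnW.
apply: jump_pullback; last exact: nC.
(* The one-step lemma excludes the point 0; the iterate avoids it because 0 is itself a partition
   point. *)
have /andP[z0 ->] := iter_tau_itv tau_iem m z01; rewrite andbT lt0r z0 andbT.
apply/eqP => zm; apply: (nC m) => //; rewrite zm; exists 0%N => //.
exact: (partition_first tau_iem).
Qed.

End Transfer.

(** * The basis *)

Section DimensionGroupBij.
Context (V : zmodType) (L : {additive V -> V}).
Hypothesis Lbij : bijective L.

Lemma dg_class_inj : injective (@dg_class V L).
Proof.
move=> f g /dg_classP[k]; elim: k => //= k IH /(bij_inj Lbij); exact: IH.
Qed.

Lemma dg_class_surj u : exists f, @dg_class V L f = u.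
Proof. by exists (repr u); exact: reprK. Qed.

Lemma dg_class_bij : bijective (@dg_class V L).
Proof.
have /choice[g gK] := dg_class_surj; exists g => // f.
by apply: dg_class_inj; rewrite gK.
Qed.

Lemma dg_shift_bij : bijective (@dg_shift V L).
Proof.
have [M LK MK] := Lbij; have [r cK rK] := dg_class_bij.
exists (fun u => dg_class L (M (r u))) => u.
  by rewrite -{1}[u]rK dg_shift_class cK LK rK.
by rewrite dg_shift_class MK rK.
Qed.

End DimensionGroupBij.

Section Basis.
Context (R : realType) (tau : R -> R) (n : nat) (a : nat -> R).
Hypothesis tau_iem : interval_exchange tau n a.
Hypothesis a_orbits : infinite_disjoint_orbits tau (a @` [set i | (0 < i < n)%N]).
Local Notation C := (a @` [set i | (i <= n)%N]).
Local Notation D := (generalized_orbit tau C).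
Local Notation CX := (cont_int (disc_space tau C)).
Local Notation L := (transfer tau C).
Local Notation step := (@step R D).
Local Notation pullback := (pullback tau_iem).

(** A visit to [a i] before time [N] would put [a j] on the strict forward orbit of [a i].
    Disjointness of infinite orbits excludes this for interior [i]; the ends 0 and 1 are treated
    separately. *)
Lemma orbit_avoids_partition y N j k : 0 <= y < 1 -> (0 < j < n)%N ->
  iter N tau y = a j -> (k < N)%N -> ~ C (iter k tau y).
Proof.
move=> y01 jn yN kN [i /= ni ik].
have Aj : (a @` [set i | (0 < i < n)%N]) (a j) by exists j.
have ikN : iter (N - k) tau (a i) = a j by rewrite ik -iterD subnK// ltnW.
have Nk : (0 < N - k)%N by rewrite subn_gt0.
have [i0|i0] := posnP i; last first.
  have ilt : (i < n)%N.
    rewrite ltn_neqAle ni andbT; apply/eqP => iN.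
    have /andP[_] := iter_tau_itv tau_iem k y01.
    by rewrite -ik iN (partition_last tau_iem) ltxx.
  have [|_ Nk0] := @a_orbits (a i) (a j) _ Aj (N - k)%N 0%N ikN.
    by exists i => //=; rewrite i0.
  by rewrite Nk0 in Nk.
(* For i = 0, step back to the preimage [x] of 0. It is a partition point, since elsewhere [tau x]
   would be a left limit and so positive. *)
have z01 : 0 <= (0 : R) < 1 by apply/andP.
have [x x01 tx] := tau_surj tau_iem z01.
rewrite i0 (partition_first tau_iem) in ikN.
have [[l /= nl lx]|nCx] := pselect (C x); last first.
  have x01' : 0 < x < 1.
    case/andP: (x01) => x0 ->; rewrite andbT lt0r x0 andbT; apply/eqP => x0'.
    by apply: nCx; exists 0%N => //; rewrite x0' (partition_first tau_iem).
  have /andP[+ _] : 0 < left_limit tau x <= 1.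
    by apply: (left_limit_itv tau_iem); case/andP: x01' => -> /ltW.
  by rewrite (left_limit_continuity tau_iem x01' nCx) tx ltxx.
(* If x = 0 then 0 is fixed and never reaches [a j]; otherwise the orbit of the interior point [a l]
   passes through 0 to [a j]. *)
have [l0|l0] := posnP l.
  have t0 m : iter m tau 0 = 0.
    elim: m => //= m ->.
    by rewrite -[X in tau X](partition_first tau_iem) -l0 lx tx.
  have jn' : (j <= n)%N by case/andP: jn => _ /ltnW.
  have : a 0 < a j by apply: (partition_lt tau_iem) jn'; case/andP: jn.
  by rewrite -ikN t0 (partition_first tau_iem) ltxx.
have lN : iter (N - k).+1 tau (a l) = a j by rewrite iterSr lx tx.
have lltn : (l < n)%N.
  rewrite ltn_neqAle nl andbT; apply/eqP => lE.
  by case/andP: x01 => _; rewrite -lx lE (partition_last tau_iem) ltxx.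
have [|//] := @a_orbits (a l) (a j) _ Aj (N - k).+1 0%N lN.
by exists l => //=; rewrite l0.
Qed.

Lemma step_free N (b : 'I_n.-1 -> nat -> int) (c : int) :
  \sum_(i < n.-1) \sum_(k < N.+1) iter k L (step (a i.+1)) *~ b i k = step 0 *~ c ->
  forall i, b i 0%N = 0.
Proof.
move=> e j.
(* The index [i] stands for the interior partition point [a i.+1]. *)
have in_n (i : 'I_n.-1) : (0 < i.+1 < n)%N by rewrite -ltn_predRL ltn_ord.
have aD (i : 'I_n.-1) : D (a i.+1) by apply: orbit_partition; case/andP: (in_n i) => _ /ltnW.
have a_gt0 : 0 < a j.+1.
  rewrite -(partition_first tau_iem) (partition_lt tau_iem)//.
  by case/andP: (in_n j) => _ /ltnW.
have aj01 : 0 <= a j.+1 < 1.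
  by rewrite ltW//= -(partition_last tau_iem) (partition_lt tau_iem)//; case/andP: (in_n j).
have [y y01 yN] := iter_tau_surj tau_iem N aj01.
have nC k : (k < N)%N -> ~ C (iter k tau y) by exact: orbit_avoids_partition yN.
have C0 : C 0 by exists 0%N => //; exact: (partition_first tau_iem).
have y_itv m : (m <= N)%N -> 0 < iter m tau y < 1.
  move=> mN; have /andP[y0 ->] := iter_tau_itv tau_iem m y01.
  rewrite andbT; move: mN; rewrite leq_eqVlt => /predU1P[->|mN]; first by rewrite yN.
  by rewrite lt0r y0 andbT; apply/eqP => ym; apply: (nC m mN); rewrite ym.
(* The jump at [y] after N inverse transfers, packaged as an additive map so that it distributes
   over the relation. *)
have [H HE] : exists H : {additive CX -> int},
    forall f, H f = jump y (iter N pullback f).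
  pose h f := jump y (iter N pullback f).
  have h_zmod : zmod_morphism h.
    move=> f g; rewrite /h -raddfB /=; congr jump.
    by elim: {e nC y_itv h yN}N => //= m ->; rewrite raddfB.
  pose H : {additive CX -> int} := HB.pack h (GRing.isZmodMorphism.Build CX int h h_zmod).
  by exists H.
have hE m f : (m <= N)%N -> H (iter (N - m) L f) = jump (iter m tau y) f.
  move=> mN; rewrite -(jump_iter_pullback tau_iem)//; last first.
    by move=> k km; apply: nC; exact: leq_trans mN.
  rewrite HE -{1}(subnKC mN) iterD; congr (jump _ (iter _ _ _)).
  by elim: (N - m)%N => // k IH; rewrite iterSr /= transferK.
have hL k (i : 'I_n.-1) : (k <= N)%N ->
    H (iter k L (step (a i.+1))) = (iter (N - k) tau y == a i.+1)%:Z.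
  move=> kN; rewrite -{1}(subKn kN) hE ?leq_subr//.
  by rewrite jump_step// y_itv// leq_subr.
have := congr1 H e; rewrite raddfMz raddf_sum.
have -> : H (step 0) = 0.
  have := hE N (step 0) (leqnn N); rewrite subnn => ->.
  by rewrite jump_step ?yN// ?gt_eqF ?a_gt0 ?(andP aj01).2//; exact: (orbit0 tau_iem).
rewrite mul0rz (bigD1 j)//= [X in _ + X]big1 ?addr0 => [|i ij]; last first.
  rewrite raddf_sum big1// => k _; rewrite raddfMz hL ?leq_ord//.
  (* A nonzero term with k > 0 would be an early visit to the partition; with k = 0 it would
     identify two distinct partition points. *)
  have [kN|] := eqVneq (iter (N - k) tau y) (a i.+1); last by rewrite mul0rz.
  have [k0|k0] := posnP k.
    rewrite k0 subn0 yN in kN; move: ij; case/negP; apply/eqP/ord_inj.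
    apply/eqP; rewrite -eqSS; apply/eqP/(partition_inj tau_iem) => //.
      by case/andP: (in_n i) => _ /ltnW.
    by case/andP: (in_n j) => _ /ltnW.
  case: (nC (N - k)%N); first by rewrite ltn_subrL k0 (leq_trans k0 (leq_ord k)).
  by rewrite kN; exists i.+1 => //=; case/andP: (in_n i) => _ /ltnW.
rewrite raddf_sum big_ord_recl /= [X in _ + X]big1 ?addr0 => [|k _]; last first.
  rewrite raddfMz (hL k.+1 j) ?ltn_ord//.
  have [kN|] := eqVneq (iter (N - k.+1) tau y) (a j.+1); last by rewrite mul0rz.
  case: (nC (N - k.+1)%N); first by rewrite ltn_subrL /= (leq_ltn_trans _ (ltn_ord k)).
  by rewrite kN; exists j.+1 => //=; case/andP: (in_n j) => _ /ltnW.
by rewrite raddfMz (hL 0%N j)// subn0 yN eqxx intz.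
Qed.

Lemma step_span (P : CX -> Prop) : P (step 0) ->
  (forall i : 'I_n.-1, P (step (a i.+1))) -> P 0 ->
  (forall f g, P f -> P g -> P (f - g)) -> (forall f, P (L f) <-> P f) ->
  forall f, P f.
Proof.
move=> P1 Pa P0 PB PL.
have Pai i : (i < n)%N -> P (step (a i)).
  case: i => [|i] ni; first by rewrite (partition_first tau_iem).
  by have ni' : (i < n.-1)%N; [rewrite ltn_predRL|exact: (Pa (Ordinal ni'))].
have D0 := orbit0 tau_iem.
(* Functions jumping only at partition points are already in the span; this absorbs all error terms
   below. *)
have jumpC f : (forall z, 0 < z < 1 -> ~ C z -> jump z f = 0) -> P f.
  move=> fC; apply: jump_span => // z z01 jz.
  have [[i /= ni iz]|/(fC z z01) jz0] := pselect (C z); last by rewrite jz0 eqxx in jz.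
  rewrite -iz; apply: Pai; rewrite ltn_neqAle ni andbT; apply/eqP => iN.
  by case/andP: z01 => _; rewrite -iz iN (partition_last tau_iem) ltxx.
have PD f g : P f -> P g -> P (f + g).
  by move=> Pf Pg; rewrite -[g]opprK; apply: (PB) => //; rewrite -sub0r; exact: PB.
have Ptau x : 0 <= x < 1 -> D x -> P (step x) <-> P (step (tau x)).
  move=> x01 Dx; have Dtx : D (tau x) by apply/(orbit_tau tau_iem).
  (* Off the partition, the pulled back step jumps at [z] exactly when tau z = tau x, that is when z
     = x, so the difference has no jump there. *)
  have Pd : P (pullback (step (tau x)) - step x).
    apply: jumpC => z z01 nCz; have /andP[z0 z1] := z01.
    have z01' : 0 <= z < 1 by rewrite z1 ltW.
    have tz01 : 0 < tau z < 1.
      have /andP[_ ->] := tau_itv tau_iem z01'; rewrite andbT.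
      rewrite -(left_limit_continuity tau_iem z01 nCz).
      have /andP[] // : 0 < left_limit tau z <= 1.
      by apply: (left_limit_itv tau_iem); rewrite z0 ltW.
    rewrite raddfB /= (jump_pullback tau_iem)// !jump_step//.
    apply/eqP; rewrite subr_eq0; apply/eqP; congr (nat_of_bool _)%:Z.
    by apply/eqP/eqP => [tzx|->//]; exact: (tau_inj tau_iem).
  rewrite -[step (tau x)](pullbackK tau_iem) PL.
  split=> [Px|Px]; first by rewrite -[pullback _](subrK (step x)); exact: PD.
  by rewrite -[step x](subKr (pullback (step (tau x)))); exact: PB.
have Piter p x : 0 <= x < 1 -> D x -> P (step x) <-> P (step (iter p tau x)).
  move=> x01; elim: p x x01 => // p IH x x01 Dx; rewrite iterSr (Ptau x)//.
  by apply: IH; [exact: (tau_itv tau_iem)|apply/(orbit_tau tau_iem)].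
move=> f; apply: jump_span => // z z01 /(jump_orbit z01) Dz.
have /andP[z0 z1] := z01; have z01' : 0 <= z < 1 by rewrite z1 ltW.
(* The forward orbits of [z] and of some [a i] meet; membership in the span travels along both, from
   [a i] to the meeting point and back to [z]. *)
have [_ /(_ z1)[i [p [q [ni zi]]]]] := orbit_sub tau_iem Dz.
have ai01 : 0 <= a i < 1.
  by have [-> ? ?] := in_piece_bound tau_iem (in_piece_ends tau_iem ni);
    rewrite (@lt_le_trans _ _ (a i.+1)).
have Dai : D (a i) by apply: orbit_partition; exact: ltnW.
by apply/(Piter p z z01' Dz); rewrite zi; apply/(Piter q (a i) ai01 Dai); exact: Pai.
Qed.

End Basis.

Theorem corollary11p8 (R : realType) (tau : R -> R) (n : nat) (a : nat -> R)
    (tau_iem : interval_exchange tau n a)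
    (a_maximal : maximal_partition tau n a)
    (a_orbits : infinite_disjoint_orbits tau (a @` [set i | (0 < i < n)%N])) :
  let C := a @` [set i | (i <= n)%N] in
  bijective (@DG_class R tau C) /\
  exists Lbij : bijective (DG_shift tau C),
    exists phi : {linear laurent_mod Lbij ->
                         ('rV[laurent]_(n.-1) * trivial_int)%type},
      bijective phi.
Proof.
move=> C; set D := generalized_orbit tau C.
have Lbij : bijective (transfer tau C).
  by exists (pullback tau_iem); [exact: transferK|exact: pullbackK].
split; first exact: dg_class_bij Lbij.
have Sbij : bijective (DG_shift tau C) by exact: dg_shift_bij Lbij.
exists Sbij.
(* The class map is an additive bijection commuting with the shift, so it carries the basis of C(X,
   Z) to one of the dimension group. *)
pose cl : cont_int (disc_space tau C) -> DG tau C := @DG_class R tau C.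
have cl_zmod : zmod_morphism cl.
  move=> f g; apply: (@addIr _ (cl g)); rewrite subrK.
  by rewrite -[LHS]dg_classD subrK.
pose clA : {additive cont_int (disc_space tau C) -> DG tau C} :=
  HB.pack cl (GRing.isZmodMorphism.Build _ _ cl cl_zmod).
have shiftE k f : iter k (DG_shift tau C) (cl f) = cl (iter k (transfer tau C) f).
  by elim: k => //= k ->; exact: dg_shift_class.
apply: (@laurent_basis_iso _ _ Sbij _ (fun i => cl (step D (a i.+1))) (cl (step D 0))).
- by apply: etrans (shiftE 1%N _) _; rewrite /= (transfer1 tau_iem).
- move=> c; rewrite -[cl _]/(clA _) -raddfMz -(raddf0 clA) => /(dg_class_inj Lbij).
  move=> /(congr1 (eval_at (plus D 0))); rewrite raddfMz raddf0 /=.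
  have -> : eval_at (plus D 0) (step D 0) = 1 by apply: step0E; exact: orbit0 tau_iem.
  by rewrite intz.
- move=> P P1 Pa P0 PB PS v; have [f <-] := @dg_class_surj _ (transfer tau C) v.
  apply: (@step_span R tau n a tau_iem (fun f => P (cl f))) => //.
  + by rewrite -[cl _]/(clA _) raddf0.
  + by move=> g h Pg Ph; rewrite -[cl _]/(clA _) raddfB; exact: PB.
  + by move=> g; rewrite -[cl (transfer tau C g)]/(cl (iter 1 _ g)) -shiftE; exact: PS.
- move=> N b c e; apply: (@step_free R tau n a tau_iem a_orbits N b c).
  apply: (dg_class_inj Lbij); rewrite -[dg_class _ _]/(clA _) -[RHS]/(clA _).
  rewrite raddf_sum raddfMz -[RHS]e; apply: eq_bigr => i _.
  by rewrite raddf_sum; apply: eq_bigr => k _; rewrite raddfMz shiftE.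
Qed.
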